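(* Let $\mathfrak{g}$ be the complex simple Lie algebra of type $\mathrm{G}_2$, let $\phi:\mathfrak{g}\to\mathfrak{gl}(V)$ be the irreducible representation with highest weight $\lambda$, let $\mu_1,\dots,\mu_s$ be the distinct dominant weights of $V$, and let $k_i=|O_{\mu_i}|$ be the size of the orbit of $\mu_i$ under the Weyl group $\mathscr{W}(\mathrm{G}_2)$ (the dihedral group of order $12$). Then $$f_\phi(z_0,L)=(f_{\mu_1})^{m_\lambda(\mu_1)}\cdots(f_{\mu_s})^{m_\lambda(\mu_s)},$$ where each $f_{\mu_i}$ is an irreducible polynomial of degree $k_i$.
   Context: $f_\phi(z_0,L)=\det(z_0I+\phi(L))$, viewed as a polynomial in $z_0$ and the coordinates of $L$ with respect to a Chevalley basis of $\mathfrak{g}$ (equivalently, a polynomial function on $\mathbb{C}\times\mathfrak{g}$). $m_\lambda(\mu)$ is the dimension of the $\mu$-weight space of $V$. Let $\mathfrak{h}$ be a Cartan subalgebra, $\mathscr{W}$ the Weyl group acting on $\mathfrak{h}^*$, $O_\mu=\mathscr{W}\mu$. Orbital factor: for semisimple $L\in\mathfrak{g}$ choose $h\in\mathfrak{h}$ conjugate to $L$ under the adjoint group (unique up to $\mathscr{W}$) and set $f_\mu(z_0,L)=\prod_{\nu\in O_\mu}(z_0+\nu(h))$; this extends uniquely to a polynomial function on $\mathbb{C}\times\mathfrak{g}$. Irreducibility is over $\mathbb{C}$ in the polynomial ring in $z_0$ and the coordinates of $L$. *)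

(* Defs.v *)
From HB Require Import structures.
From mathcomp Require Import all_boot all_order all_algebra.
From mathcomp Require Import reals.
From mathcomp Require Import complex.
From mathcomp Require Import mpoly.

Set Implicit Arguments.
Unset Strict Implicit.
Unset Printing Implicit Defensive.

Import Order.TTheory GRing.Theory Num.Theory.
Local Open Scope ring_scope.

(* The complex simple Lie algebra g of type G2, given by its structure       *)
(* constants in a Chevalley basis (b_0, ..., b_13):                          *)
(*   b_0 = h_1, b_1 = h_2           simple coroots (alpha_1 short,           *)
(*                                                  alpha_2 long)            *)
(*   b_2 .. b_7  = e_a  for the positive roots                               *)
(*        a = a1, a2, a1+a2, 2a1+a2, 3a1+a2, 3a1+2a2                          *)
(*   b_8 .. b_13 = e_{-a} for the same roots, in the same order.             *)
(* [b_i, b_j] = sum_k g2_sc i j k b_k.  The table lists the nonzero entries  *)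
(* (i, j, k, c).  It was computed from a faithful 7-dimensional matrix       *)
(* realisation of G2 (so it satisfies antisymmetry and Jacobi), and checked  *)
(* to be a Chevalley basis: [h,e_a] = a(h) e_a, [e_a,e_{-a}] = h_a (coroot), *)
(* [e_a,e_b] = +-(p+1) e_{a+b}.                                              *)

Definition g2_table : seq (nat * nat * nat * int) :=
  [:: (0, 2, 2, 2); (0, 3, 3, -3); (0, 4, 4, -1); (0, 5, 5, 1); (0, 6, 6, 3); (0, 8, 8, -2); (0, 9, 9, 3); (0, 10, 10, 1); (0, 11, 11, -1); (0, 12, 12, -3); (1, 2, 2, -1); (1, 3, 3, 2); (1, 4, 4, 1); (1, 6, 6, -1); (1, 7, 7, 1); (1, 8, 8, 1); (1, 9, 9, -2); (1, 10, 10, -1); (1, 12, 12, 1); (1, 13, 13, -1); (2, 0, 2, -2); (2, 1, 2, 1); (2, 3, 4, 1); (2, 4, 5, 2); (2, 5, 6, 3); (2, 8, 0, 1); (2, 10, 9, -3); (2, 11, 10, -2); (2, 12, 11, -1); (3, 0, 3, 3); (3, 1, 3, -2); (3, 2, 4, -1); (3, 6, 7, -1); (3, 9, 1, 1); (3, 10, 8, 1); (3, 13, 12, 1); (4, 0, 4, 1); (4, 1, 4, -1); (4, 2, 5, -2); (4, 5, 7, 3); (4, 8, 3, -3); (4, 9, 2, 1); (4, 10, 0, 1); (4, 10, 1, 3); (4, 11, 8, 2); (4, 13, 11, -1); (5, 0, 5, -1); (5, 2, 6, -3); (5, 4, 7, -3); (5, 8, 4, -2); (5, 10, 2, 2); (5,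 11, 0, 2); (5, 11, 1, 3); (5, 12, 8, 1); (5, 13, 10, 1); (6, 0, 6, -3); (6, 1, 6, 1); (6, 3, 7, 1); (6, 8, 5, -1); (6, 11, 2, 1); (6, 12, 0, 1); (6, 12, 1, 1); (6, 13, 9, -1); (7, 1, 7, -1); (7, 9, 6, 1); (7, 10, 5, -1); (7, 11, 4, 1); (7, 12, 3, -1); (7, 13, 0, 1); (7, 13, 1, 2); (8, 0, 8, 2); (8, 1, 8, -1); (8, 2, 0, -1); (8, 4, 3, 3); (8, 5, 4, 2); (8, 6, 5, 1); (8, 9, 10, -1); (8, 10, 11, -2); (8, 11, 12, -3); (9, 0, 9, -3); (9, 1, 9, 2); (9, 3, 1, -1); (9, 4, 2, -1); (9, 7, 6, -1); (9, 8, 10, 1); (9, 12, 13, 1); (10, 0, 10, -1); (10, 1, 10, 1); (10, 2, 9, 3); (10, 3, 8, -1); (10, 4, 0, -1); (10, 4, 1, -3); (10, 5, 2, -2); (10, 7, 5, 1); (10, 8, 11, 2); (10, 11, 13, -3); (11, 0, 11, 1); (11, 2, 10, 2); (11, 4, 8, -2); (11, 5, 0, -2); (11, 5, 1, -3); (11, 6, 2, -1); (11, 7, 4, -1); (11, 8, 12, 3); (11, 10, 13, 3); (12, 0, 12, 3); (12, 1, 12, -1); (12, 2, 11, 1); (12, 5, 8, -1); (12, 6, 0, -1); (12, 6, 1, -1); (12, 7, 3, 1); (12, 9, 13, -1); (13, 1, 13, 1); (13, 3, 12, -1); (13, 4, 11, 1); (13, 5, 10, -1); (13, 6, 9, 1);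 (13, 7, 0, -1); (13, 7, 1, -2) ].

Definition g2_sc (i j k : 'I_14) : int :=
  \sum_(t <- g2_table | (t.1.1.1 == i :> nat) && (t.1.1.2 == j :> nat)
                          && (t.1.2 == k :> nat)) t.2.

Definition h1 : 'I_14 := inord 0.
Definition h2 : 'I_14 := inord 1.
Definition is_root_vector (i : 'I_14) : bool := (2 <= i)%N.

Section G2.

Variable R : realType.
Local Notation C := (R[i]).

(* A representation phi : g -> gl(V), V = C^n (column vectors), given by the *)
(* images of the basis vectors; phi(sum x_i b_i) = sum x_i phi_i.            *)
Definition is_g2_rep (n : nat) (phi : 'I_14 -> 'M[C]_n) : Prop :=
  forall i j : 'I_14,
    phi i *m phi j - phi j *m phi i = \sum_(k < 14) (g2_sc i j k)%:~R *: phi k.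

(* A subspace W of column vectors is encoded by the row space of U = W^T;    *)
(* phi_i W <= W  <->  (U *m phi_i^T <= U)%MS.                                *)
Definition irreducible_rep (n : nat) (phi : 'I_14 -> 'M[C]_n) : Prop :=
  (0 < n)%N /\
  forall U : 'M[C]_n,
    (forall i, (U *m (phi i)^T <= U)%MS) -> U = 0 \/ row_full U.

(* A weight mu in h^* is encoded by (mu(h_1), mu(h_2)). *)
Definition weight := (C * C)%type.

Definition wmult (n : nat) (phi : 'I_14 -> 'M[C]_n) (mu : weight) : nat :=
  \rank (eigenspace (phi h1)^T mu.1 :&: eigenspace (phi h2)^T mu.2)%MS.

Definition dominant (mu : weight) : Prop :=
  (exists k : nat, mu.1 = k%:R) /\ (exists k : nat, mu.2 = k%:R).

(* simple roots alpha_i as weights: alpha_i(h_k) is the eigenvalue of ad h_k *)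
(* on e_{alpha_i} (b_2 = e_{alpha_1}, b_3 = e_{alpha_2}).                     *)
Definition simple_root (i : 'I_14) : weight :=
  ((g2_sc h1 i i)%:~R, (g2_sc h2 i i)%:~R).

Definition sref1 (mu : weight) : weight :=
  let a := simple_root (inord 2) in (mu.1 - mu.1 * a.1, mu.2 - mu.1 * a.2).
Definition sref2 (mu : weight) : weight :=
  let a := simple_root (inord 3) in (mu.1 - mu.2 * a.1, mu.2 - mu.2 * a.2).

Definition weyl_act (w : seq bool) (mu : weight) : weight :=
  foldr (fun b nu => if b then sref2 nu else sref1 nu) mu w.

Fixpoint words (k : nat) : seq (seq bool) :=
  if k is k'.+1 then [:: [::]] ++ [seq b :: w | b <- [:: false; true], w <- words k']
  else [:: [::]].

(* The Weyl group W(G2) = <s_1, s_2> has order 12, so each of its elements *)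
(* is a word of length <= 11 in s_1, s_2; hence the orbit O_mu = W mu is:   *)
Definition weyl_orbit (mu : weight) : seq weight :=
  undup [seq weyl_act w mu | w <- words 11].

(* Variable 0 is z_0, variable (lift ord0 i) is the coordinate x_i of L     *)
(* with respect to the Chevalley basis b_i.                                 *)
Definition Pol := {mpoly C[15]}.

Definition pt (z : C) (x : 'cV[C]_14) : 'I_15 -> C :=
  fun j => if unlift ord0 j is Some i then x i ord0 else z.

Definition f_phi (n : nat) (phi : 'I_14 -> 'M[C]_n) : Pol :=
  \det ((('X_ord0 : Pol)%:M) +
        \sum_(i < 14) ('X_(lift ord0 i) : Pol) *: map_mx (fun c => c%:MP) (phi i)).

Definition ad_mx (i : 'I_14) : 'M[C]_14 :=
  \matrix_(k < 14, j < 14) (g2_sc i j k)%:~R.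

(* exp(t ad e_a) for a root vector e_a (ad e_a is nilpotent, (ad e_a)^14=0) *)
Definition Ad_exp (i : 'I_14) (t : C) : 'M[C]_14 :=
  \sum_(m < 14) (t ^+ m / (m`!)%:R) *: (ad_mx i) ^+ m.

(* The orbital factor f_mu: the polynomial function on C x g which is       *)
(* invariant under the adjoint group (generated by the exp(t ad e_a)) and   *)
(* equals prod_{nu in O_mu} (z_0 + nu(h)) at (z_0, h), h = a h_1 + b h_2.   *)
Definition orbital_factor (mu : weight) (f : Pol) : Prop :=
  (forall z a b : C,
      f.@[pt z (\col_(k < 14) (if k == h1 then a else if k == h2 then b else 0))]
      = \prod_(nu <- weyl_orbit mu) (z + (a * nu.1 + b * nu.2))) /\
  (forall (i : 'I_14) (t z : C) (x : 'cV[C]_14), is_root_vector i ->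
      f.@[pt z (Ad_exp i t *m x)] = f.@[pt z x]).

Definition mirreducible (p : Pol) : Prop :=
  p != 0 /\ p \isn't a GRing.unit /\
  forall q r : Pol, p = q * r -> q \is a GRing.unit \/ r \is a GRing.unit.

End G2.

(* Main.v *)
Require Import Defs.
From HB Require Import structures.
From mathcomp Require Import all_boot all_order all_algebra.
From mathcomp Require Import perm reals complex mpoly ring zify.

Set Implicit Arguments.
Unset Strict Implicit.
Unset Printing Implicit Defensive.

Import Order.TTheory GRing.Theory Num.Theory.
Local Open Scope ring_scope.

(** Polynomial functions on [C x g] carry the derivations [gD i] induced by
    [ad b_i]. A function killed by the [gD i] of the root vectors is invariant
    under the adjoint group, hence its restriction to the Cartan subalgebra [h] is
    invariant under the Weyl group, and it is determined by this restriction: if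
    it vanishes on [h], then so do all its partial derivatives, because [gD i]
    restricts to [h] as the root of [b_i] times a partial derivative.

    [f_phi] is killed by [gD i] (Jacobi's formula for the derivative of a
    determinant), and on [h] it is the product of [z + nu] over the weights [nu].
    Sl2-theory makes the weights integral, and invariance makes the multiplicities
    constant on Weyl orbits. The orbital factors are explicit polynomials in [z]
    and the invariants [tr (ad x)^2], [tr (ad x)^6]; comparing restrictions to [h]
    gives the factorization.

    If [f_mu = q r], then along [t |-> exp (t ad e) x] the product of [q] and [r]
    is constant, so both are constant and the restriction of [q] to [h] is again
    Weyl invariant. One of [q], [r] vanishes on the hyperplane [z = - mu], hence on
    all hyperplanes [z = - w mu], so it has full degree and the other is a unit. *)

(** * Derivations of a commutative ring, applied to determinants and traces *)

Section Derivations.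

Variables (A : comNzRingType) (D : A -> A).
Hypothesis DD : {morph D : x y / x + y}.
Hypothesis DM : forall x y, D (x * y) = D x * y + x * D y.

Lemma derivation0 : D 0 = 0.
Proof. by apply: (addrI (D 0)); rewrite -DD !addr0. Qed.

Lemma derivation1 : D 1 = 0.
Proof. by apply: (addrI (D 1)); rewrite -{1}[D 1]mulr1 -{2}[D 1]mul1r -DM mulr1 addr0. Qed.

Lemma derivationN x : D (- x) = - D x.
Proof. by apply: (addrI (D x)); rewrite -DD !subrr derivation0. Qed.

Lemma derivation_sum I (r : seq I) (P : pred I) (F : I -> A) :
  D (\sum_(i <- r | P i) F i) = \sum_(i <- r | P i) D (F i).
Proof. by apply: (big_morph D DD derivation0). Qed.

Lemma derivation_exp_eq0 x k : D x = 0 -> D (x ^+ k) = 0.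
Proof.
by move=> Dx; elim: k => [|k IH]; rewrite ?derivation1 // exprS DM Dx IH mul0r mulr0 addr0.
Qed.

Lemma derivation_prod_eq0 (I : eqType) (r : seq I) (F : I -> A) :
  {in r, forall i, D (F i) = 0} -> D (\prod_(i <- r) F i) = 0.
Proof.
elim: r => [|i r IH] h; rewrite ?big_nil ?derivation1 // big_cons DM IH.
  by rewrite h ?mem_head // mul0r mulr0 addr0.
by move=> j jr; rewrite h // inE jr orbT.
Qed.

Lemma derivation_prod (I : finType) (F : I -> A) :
  D (\prod_i F i) = \sum_i D (F i) * \prod_(j | j != i) F j.
Proof.
suff H (r : seq I) : uniq r -> D (\prod_(i <- r) F i)
    = \sum_(i <- r) D (F i) * \prod_(j <- r | j != i) F j.
  exact/H/index_enum_uniq.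
elim: r => [|i r IH] /=; first by rewrite !big_nil derivation1.
case/andP=> ir ur; rewrite !big_cons DM IH // eqxx /=; congr (_ + _).
  congr (_ * _); rewrite [LHS]big_seq [RHS]big_seq_cond; apply: eq_bigl => j.
  by case: eqP => [->|]; rewrite ?andbT // (negbTE ir).
rewrite big_distrr /= big_seq [RHS]big_seq; apply: eq_bigr => j jr.
rewrite big_cons; case: eqP => [e|_]; first by rewrite e jr in ir.
by rewrite mulrCA.
Qed.

(** Jacobi's formula, obtained row by row: [N i] is [M] with row [i] differentiated, and expanding
    its determinant along that row produces the entries of the adjugate. *)
Lemma derivation_det n (M : 'M[A]_n) : D (\det M) = \tr (map_mx D M *m \adj M).
Proof.
rewrite /mxtrace; under [RHS]eq_bigr => i _ do rewrite mxE.
pose N i := \matrix_(k, j) if k == i then D (M i j) else M k j.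
transitivity (\sum_i \det (N i)).
  rewrite /determinant derivation_sum exchange_big /=; apply: eq_bigr => s _.
  have D1 : D ((-1) ^+ s) = 0.
    by apply: derivation_exp_eq0; rewrite derivationN derivation1 oppr0.
  rewrite DM D1 mul0r add0r derivation_prod big_distrr /=; apply: eq_bigr => i _.
  rewrite [in RHS](bigD1 i) //= mxE eqxx; congr (_ * (_ * _)).
  by apply: eq_bigr => j /negbTE ji; rewrite mxE ji.
apply: eq_bigr => i _; rewrite (expand_det_row _ i); apply: eq_bigr => j _.
rewrite !mxE eqxx; congr (_ * _); rewrite /cofactor; congr (_ * \det _).
by apply/matrixP => k l; rewrite !mxE eq_sym (negbTE (neq_lift _ _)).
Qed.

(** An infinitesimal conjugation does not move the determinant: after Jacobi's formula both halves
    of the trace reduce to [\det M] times the trace of [B]. *)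
Lemma derivation_det_eq0 n (M B : 'M[A]_n) :
  map_mx D M = B *m M - M *m B -> D (\det M) = 0.
Proof.
move=> e; rewrite derivation_det e mulmxBl -!mulmxA [M *m (B *m _)]mulmxA.
rewrite linearB /= mul_mx_adj [\tr (M *m B *m _)]mxtrace_mulC mulmxA mul_adj_mx.
by rewrite [\tr (B *m _)]mxtrace_mulC subrr.
Qed.

Lemma map_derivationM n m p (M : 'M[A]_(n, m)) (N : 'M[A]_(m, p)) :
  map_mx D (M *m N) = map_mx D M *m N + M *m map_mx D N.
Proof.
apply/matrixP => i j; rewrite !mxE derivation_sum -big_split /=.
by apply: eq_bigr => k _; rewrite DM !mxE.
Qed.

(** By the Leibniz rule the commutator form of the derivative passes from [M] to its powers, and a
    commutator has trace 0. *)
Lemma derivation_trX_eq0 n (M B : 'M[A]_n.+1) k :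
  map_mx D M = B *m M - M *m B -> D (\tr (M ^+ k)) = 0.
Proof.
move=> e.
have H : map_mx D (M ^+ k) = B *m M ^+ k - M ^+ k *m B.
  elim: k => [|k IH].
    rewrite expr0 mulmx1 mul1mx subrr; apply/matrixP => i j; rewrite !mxE.
    by case: eqP; rewrite ?derivation1 ?derivation0.
  rewrite exprS -mulmxE map_derivationM IH e mulmxBl mulmxBr !mulmxA.
  by rewrite addrA subrK.
transitivity (\tr (map_mx D (M ^+ k))).
  by rewrite /mxtrace derivation_sum; apply: eq_bigr => i _; rewrite mxE.
by rewrite H linearB /= mxtrace_mulC subrr.
Qed.

End Derivations.

(** * Multivariate polynomials: chain rule and vanishing criteria *)

Section Mpoly.

Variables (F : numFieldType) (n : nat).
Implicit Types p q : {mpoly F[n]}.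

Lemma mpoly_gen_ind (P : {mpoly F[n]} -> Prop) :
  (forall c, P c%:MP) -> (forall i, P 'X_i) ->
  (forall p q, P p -> P q -> P (p + q)) ->
  (forall p q, P p -> P q -> P (p * q)) -> forall p, P p.
Proof.
move=> PC PX PD PM; elim/mpolyind => [|c m p _ _ Pp]; first by rewrite -mpolyC0.
apply: PD => //; rewrite -mul_mpolyC; apply: (PM) => //; rewrite mpolyXE_id.
apply: (big_ind P); [by rewrite -mpolyC1|exact: PM|move=> i _].
by elim: (m i) => [|k IH]; rewrite ?expr0 -?mpolyC1 // exprS; apply: PM.
Qed.

Lemma mderivXU i j : ('X_j : {mpoly F[n]})^`M(i) = (i == j)%:R.
Proof.
rewrite mderivX mnm1E eq_sym; case: eqP => [->|_]; last by rewrite scale0r.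
have -> : (U_(j) - U_(j) = 0)%MM by apply/mnmP => k; rewrite mnmBE subnn mnm0E.
by rewrite scale1r mpolyX0.
Qed.

Lemma mmapXU (S : comNzRingType) (f : {rmorphism F -> S}) (u : 'I_n -> S) i :
  mmap f u 'X_i = u i.
Proof. by rewrite mmapX mmap1U. Qed.

(** The chain rule for a substitution [u], for any derivation that kills the coefficients. It serves
    for polynomial curves as well as for restriction to the Cartan subalgebra. *)
Lemma derivation_mmap (S : comNzRingType) (D : S -> S) (f : {rmorphism F -> S})
    (u : 'I_n -> S) p :
  {morph D : x y / x + y} -> (forall x y, D (x * y) = D x * y + x * D y) ->
  (forall c, D (f c) = 0) ->
  D (mmap f u p) = \sum_i mmap f u p^`M(i) * D (u i).
Proof.
move=> DD DM Df; elim/mpoly_gen_ind: p => [c|j|p q Hp Hq|p q Hp Hq].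
- by rewrite mmapC Df big1 // => i _; rewrite mderivC rmorph0 mul0r.
- rewrite mmapXU (bigD1 j) //= mderivXU eqxx rmorph1 mul1r big1 ?addr0 //.
  by move=> i /negbTE ij; rewrite mderivXU ij rmorph0 mul0r.
- rewrite rmorphD DD Hp Hq -big_split /=; apply: eq_bigr => i _.
  by rewrite mderivD rmorphD mulrDl.
rewrite rmorphM DM Hp Hq big_distrl big_distrr -big_split /=.
apply: eq_bigr => i _; rewrite mderivM rmorphD !rmorphM; ring.
Qed.

Lemma horner_mmap (u : 'I_n -> {poly F}) p t :
  (mmap (polyC : {rmorphism F -> {poly F}}) u p).[t] = p.@[fun i => (u i).[t]].
Proof.
elim/mpoly_gen_ind: p => [c|j|p q Hp Hq|p q Hp Hq].
- by rewrite mmapC mevalC hornerC.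
- by rewrite mmapXU mevalXU.
- by rewrite rmorphD mevalD hornerD Hp Hq.
- by rewrite rmorphM mevalM hornerM Hp Hq.
Qed.

Lemma mderiv_eq0_const p : (forall i, p^`M(i) = 0) -> p = (p@_0)%:MP.
Proof.
move=> h; apply/mpolyP => m; rewrite mcoeffC.
have [->|m0] := eqVneq m 0%MM; first by rewrite mulr1.
rewrite mulr0.
have [i mi] : exists i, (0 < m i)%N.
  case: (boolP [exists i, (0 < m i)%N]) => [/existsP //|].
  rewrite negb_exists => /forallP H.
  by case/eqP: m0; apply/mnmP => i; rewrite mnm0E; have := H i; lia.
have /(congr1 (mcoeff (m - U_(i))%MM)) := h i.
rewrite mcoeff_mderiv mcoeff0 submK; last first.
  by apply/mnm_lepP => j; rewrite mnm1E; case: eqP => [<-|].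
by move/eqP; rewrite mulrn_eq0 /= => /eqP.
Qed.

Lemma msize_mderiv p i : (msize p^`M(i) <= (msize p).-1)%N.
Proof.
rewrite msizeE; apply/bigmax_leqP_seq => m /=.
rewrite mcoeff_msupp mcoeff_mderiv mulrn_eq0 /= => h _.
have := @msize_mdeg_lt _ _ p (m + U_(i))%MM; rewrite mcoeff_msupp h => /(_ isT).
by rewrite mdegD mdeg1; lia.
Qed.

Lemma poly_horner_eq0 (p : {poly F}) : (forall t, p.[t] = 0) -> p = 0.
Proof.
move=> h; apply/eqP/negPn/negP => p0.
have := @max_poly_roots _ p [seq k%:R | k <- iota 0 (size p)] p0.
rewrite size_map size_iota ltnn; move=> H; suff: false by [].
apply: H; first by apply/allP => x _; apply/eqP/h.
by rewrite map_inj_uniq ?iota_uniq // => a b /eqP; rewrite eqr_nat => /eqP.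
Qed.

Lemma deriv_eq0_polyC (p : {poly F}) : p^`() = 0 -> p = (p`_0)%:P.
Proof.
move=> h; apply/polyP => -[|i]; rewrite coefC //=.
have /(congr1 (fun q : {poly F} => q`_i)) := h.
by rewrite coef_deriv coef0 => /eqP; rewrite mulrn_eq0 /= => /eqP.
Qed.

Lemma meval_mmap k (u : 'I_n -> {mpoly F[k]}) p v :
  (mmap (@mpolyC k F : {rmorphism F -> {mpoly F[k]}}) u p).@[v] = p.@[fun i => (u i).@[v]].
Proof.
elim/mpoly_gen_ind: p => [c|j|p q Hp Hq|p q Hp Hq].
- by rewrite mmapC !mevalC.
- by rewrite mmapXU mevalXU.
- by rewrite rmorphD !mevalD Hp Hq.
- by rewrite rmorphM !mevalM Hp Hq.
Qed.

(** Induction on the degree: the partial derivatives vanish everywhere too, so they are 0 and [p] is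
    constant. *)
Lemma meval_eq0 p : (forall v, p.@[v] = 0) -> p = 0.
Proof.
have [k] := ubnP (msize p); elim: k p => // k IH p szp h.
have [p0|p0] := eqVneq (msize p) 0%N; first by apply/eqP; rewrite -msize_poly_eq0 p0.
have dp i : p^`M(i) = 0.
  apply: IH => [|v]; first by have := msize_mderiv p i; lia.
  (* The line through [v] in direction [i]; its derivative at 0 is the partial derivative of [p] at
     [v]. *)
  pose u j : {poly F} := (v j)%:P + (j == i)%:R *: 'X.
  have := @derivation_mmap _ (@deriv F) (polyC : {rmorphism F -> {poly F}}) u p
    (@derivD F) (@derivM F) (@derivC F).
  rewrite [mmap _ _ p]poly_horner_eq0 => [|t]; last by rewrite horner_mmap h.
  rewrite deriv0 (bigD1 i) //= big1 => [|j /negbTE ji]; last first.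
    by rewrite /u ji scale0r addr0 derivC mulr0.
  rewrite addr0 /u eqxx scale1r derivD derivC derivX add0r mulr1.
  move=> /(congr1 (horner^~ 0)); rewrite horner0 horner_mmap => e.
  rewrite [RHS]e; apply: meval_eq => j.
  by rewrite hornerD hornerC hornerZ hornerX mulr0 addr0.
rewrite (mderiv_eq0_const dp); have := h (fun=> 0).
by rewrite {1}(mderiv_eq0_const dp) mevalC => ->; rewrite mpolyC0.
Qed.

End Mpoly.

(** * Structure constants in computable form, and the identities checked on them *)

Definition scn (i j k : nat) : int :=
  foldr (fun t s => if (t.1.1.1 == i) && (t.1.1.2 == j) && (t.1.2 == k)
                    then t.2 + s else s) 0 g2_table.

Lemma g2_scE i j k : g2_sc i j k = scn i j k.
Proof. by rewrite /g2_sc unlock /scn /reducebig; elim: g2_table => //= t r ->. Qed.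

(** Tabulated once, so that the exhaustive checks below only perform lookups instead of scanning
    [g2_table] for each index triple. *)
Definition sc_table : seq (seq (seq int)) :=
  Eval vm_compute in
  [seq [seq [seq scn i j k | k <- iota 0 14] | j <- iota 0 14] | i <- iota 0 14].

Definition sct (i j k : nat) : int := nth 0 (nth [::] (nth [::] sc_table i) j) k.

Lemma ord_allP n (P : pred nat) : all P (iota 0 n) -> forall i : 'I_n, P i.
Proof. by move=> /allP h i; apply: h; rewrite mem_iota ltn_ord. Qed.

Lemma g2_sctE i j k : g2_sc i j k = sct i j k.
Proof.
rewrite g2_scE.
have H : all (fun i => all (fun j => all (fun k => scn i j k == sct i j k)
  (iota 0 14)) (iota 0 14)) (iota 0 14) by vm_compute.
by have /eqP := ord_allP (ord_allP (ord_allP H i) j) k.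
Qed.

Definition isum (f : nat -> int) : int := foldr (fun k s => f k + s) 0 (iota 0 14).

Lemma isumE (f : nat -> int) : \sum_(k < 14) f k = isum f.
Proof. by rewrite -(big_mkord xpredT) /index_iota subn0 unlock. Qed.

(** The Jacobi identity in coordinates, in the form that makes ad a representation; decided by
    evaluating all index quadruples. *)
Lemma g2_sc_jacobi (i j l m : 'I_14) :
  \sum_k g2_sc i k m * g2_sc j l k - \sum_k g2_sc j k m * g2_sc i l k
    = \sum_k g2_sc i j k * g2_sc k l m.
Proof.
under eq_bigr do rewrite !g2_sctE; under [X in _ - X]eq_bigr do rewrite !g2_sctE.
under [RHS]eq_bigr do rewrite !g2_sctE.
rewrite (isumE (fun k => sct i k m * sct j l k)) (isumE (fun k => sct j k m * sct i l k)).
rewrite (isumE (fun k => sct i j k * sct k l m)).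
have H : all (fun i => all (fun j => all (fun l => all (fun m =>
    isum (fun k => sct i k m * sct j l k) - isum (fun k => sct j k m * sct i l k)
     == isum (fun k => sct i j k * sct k l m))
  (iota 0 14)) (iota 0 14)) (iota 0 14)) (iota 0 14) by vm_compute.
by have /eqP := ord_allP (ord_allP (ord_allP (ord_allP H i) j) l) m.
Qed.

(* The value of the root of [b_i] at the coroot [h_(k+1)]; it is [0] for [i < 2]. *)
Definition rt (k i : nat) : int := sct k i i.

Definition adZ (i : 'I_14) : 'M[int]_14 := \matrix_(k, j) g2_sc i j k.

(** Root strings of G2 have at most four members, hence the exponent 4. The check squares the matrix
    twice to stay cheap. *)
Lemma adZ_nilp i : is_root_vector i -> adZ i ^+ 4 = 0.
Proof.
rewrite /is_root_vector => i2; rewrite (exprM _ 2 2).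
pose sq i a b := isum (fun k => sct i k a * sct i b k).
have sqE a b : (adZ i ^+ 2) a b = sq i a b.
  rewrite expr2 mxE /sq -isumE; apply: eq_bigr => k _.
  by rewrite !mxE !g2_sctE.
apply/matrixP => a b; rewrite expr2 !mxE.
under eq_bigr do rewrite !sqE; rewrite (isumE (fun k => sq i a k * sq i k b)).
have H : all (fun i => (2 <= i)%N ==> all (fun a => all (fun b =>
    isum (fun k => sq i a k * sq i k b) == 0)
  (iota 0 14)) (iota 0 14)) (iota 0 14) by vm_compute.
by have /implyP /(_ i2) H1 := ord_allP H i; have /eqP := ord_allP (ord_allP H1 a) b.
Qed.

Lemma val_h1 : h1 = 0 :> nat. Proof. by rewrite /h1 inordK. Qed.
Lemma val_h2 : h2 = 1 :> nat. Proof. by rewrite /h2 inordK. Qed.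

Lemma g2_sc_h1 i k : g2_sc h1 i k = if i == k then rt 0 i else 0.
Proof.
rewrite g2_sctE val_h1 -val_eqE.
have H : all (fun i => all (fun k => sct 0 i k == if i == k then rt 0 i else 0)
  (iota 0 14)) (iota 0 14) by vm_compute.
by have /eqP := ord_allP (ord_allP H i) k.
Qed.

Lemma g2_sc_h2 i k : g2_sc h2 i k = if i == k then rt 1 i else 0.
Proof.
rewrite g2_sctE val_h2 -val_eqE.
have H : all (fun i => all (fun k => sct 1 i k == if i == k then rt 1 i else 0)
  (iota 0 14)) (iota 0 14) by vm_compute.
by have /eqP := ord_allP (ord_allP H i) k.
Qed.

Lemma g2_scN i j k : g2_sc i j k = - g2_sc j i k.
Proof.
rewrite !g2_sctE.
have H : all (fun i => all (fun j => all (fun k => sct i j k == - sct j i k)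
  (iota 0 14)) (iota 0 14)) (iota 0 14) by vm_compute.
by have /eqP := ord_allP (ord_allP (ord_allP H i) j) k.
Qed.

Lemma rt_neq0 (i : 'I_14) : is_root_vector i -> (rt 0 i != 0) || (rt 1 i != 0).
Proof.
have H : all (fun i => (2 <= i)%N ==> (rt 0 i != 0) || (rt 1 i != 0)) (iota 0 14).
  by vm_compute.
exact/implyP/(ord_allP H i).
Qed.

(** * The adjoint representation and the simple reflections as products of exponentials *)

Section Adjoint.

Variable F : numFieldType.
Implicit Types (x y : 'cV[F]_14) (a b c t z : F).

Definition adm (i : 'I_14) : 'M[F]_14 := map_mx intr (adZ i).

Definition Adx (i : 'I_14) t : 'M[F]_14 :=
  \sum_(m < 14) (t ^+ m / (m`!)%:R) *: adm i ^+ m.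

Definition is_rep n (phi : 'I_14 -> 'M[F]_n) : Prop :=
  forall i j, phi i *m phi j - phi j *m phi i = \sum_(k < 14) (g2_sc i j k)%:~R *: phi k.

Lemma adm_rep : is_rep adm.
Proof.
move=> i j; apply/matrixP => m l; rewrite !mxE summxE.
under eq_bigr do rewrite !mxE -intrM; under [X in _ - X]eq_bigr do rewrite !mxE -intrM.
under [RHS]eq_bigr do rewrite !mxE -intrM.
by rewrite -!rmorph_sum -rmorphB /= g2_sc_jacobi.
Qed.

Lemma adm_nilp i : is_root_vector i -> adm i ^+ 4 = 0.
Proof.
by move=> i2; rewrite /adm -rmorphXn /= adZ_nilp // map_mx0.
Qed.

Definition evec (j : nat) : 'cV[F]_14 := delta_mx (inord j) ord0.

Definition hvec a b : 'cV[F]_14 :=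
  \col_(k < 14) (if k == h1 then a else if k == h2 then b else 0).

Lemma hvecE a b : hvec a b = a *: evec 0 + b *: evec 1.
Proof.
apply/matrixP => k j; rewrite !mxE (ord1 j) !eqxx !andbT -/h1 -/h2.
have [->|_] := eqVneq k h1; last by case: eqVneq => _ /=; rewrite ?mulr1 ?mulr0 ?addr0 ?add0r.
have -> : (h1 == h2) = false by rewrite -val_eqE /= val_h1 val_h2.
by rewrite mulr1 mulr0 addr0.
Qed.

Lemma adm_evec i j k0 (c : int) : (i < 14)%N -> (j < 14)%N -> (k0 < 14)%N ->
  all (fun k => sct i j k == if k == k0 then c else 0) (iota 0 14) ->
  adm (inord i) *m evec j = c%:~R *: evec k0.
Proof.
move=> i14 j14 k14 H; rewrite -colE; apply/matrixP => k l.
rewrite !mxE (ord1 l) eqxx andbT g2_sctE !inordK //.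
have /eqP -> := ord_allP H k; rewrite -val_eqE /= inordK //.
by case: eqP; rewrite ?mulr1 ?mulr0.
Qed.

Lemma Adx_vec i t x :
  adm i *m (adm i *m (adm i *m x)) = 0 ->
  Adx i t *m x = x + t *: (adm i *m x) + (t ^+ 2 / 2) *: (adm i *m (adm i *m x)).
Proof.
move=> h; rewrite /Adx mulmx_suml 3!big_ord_recl big1 => [|m _].
  rewrite addr0 !lift0 /= !(expr0, expr1) -!scalemxAl mul1mx !factS fact0 !muln1.
  by rewrite !divr1 scale1r addrA [adm i ^+ 2]expr2 -mulmxE mulmxA.
rewrite -scalemxAl !lift0.
have -> : adm i ^+ m.+3 = adm i ^+ m * adm i * adm i * adm i.
  by rewrite !exprSr.
by rewrite -!mulmxE -!mulmxA h !mulmx0 scaler0.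
Qed.

(* [exp (ad e) exp (- ad f) exp (ad e)] acts on the Cartan subalgebra as the
   simple reflection [x |-> x - c h], where [c] is the value of the root at [x]. *)
Lemma Adx_reflection i j x (ve vf vh : 'cV[F]_14) c :
  adm i *m x = - c *: ve -> adm i *m ve = 0 -> adm i *m vh = - 2 *: ve ->
  adm j *m x = c *: vf -> adm j *m ve = - vh -> adm j *m vf = 0 ->
  adm j *m vh = 2 *: vf ->
  Adx i 1 *m (Adx j (- 1) *m (Adx i 1 *m x)) = x - c *: vh.
Proof.
move=> Ax Ae Ah Bx Be Bf Bh.
have -> : Adx i 1 *m x = x - c *: ve.
  have A2 : adm i *m (adm i *m x) = 0 by rewrite Ax -scalemxAr Ae scaler0.
  by rewrite Adx_vec A2 ?mulmx0 // Ax scaler0 addr0 scale1r scaleNr.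
have B1 : adm j *m (x - c *: ve) = c *: vf + c *: vh.
  by rewrite mulmxBr -scalemxAr Bx Be scalerN opprK.
have B2 : adm j *m (c *: vf + c *: vh) = (c * 2) *: vf.
  by rewrite mulmxDr -!scalemxAr Bf Bh scaler0 add0r scalerA.
have -> : Adx j (- 1) *m (x - c *: ve) = x - c *: ve - c *: vh.
  have B3 : adm j *m ((c * 2) *: vf) = 0 by rewrite -scalemxAr Bf scaler0.
  rewrite Adx_vec B1 B2 // scalerA.
  have -> : (- 1) ^+ 2 / 2 * (c * 2) = c by field.
  by rewrite scaleN1r opprD addrA -addrA [- _ + _]addrC addrA addrNK.
have A1 : adm i *m (x - c *: ve - c *: vh) = c *: ve.
  rewrite !mulmxBr -!scalemxAr Ax Ae Ah scaler0 subr0 scalerA -scalerBl.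
  by congr (_ *: _); ring.
have A2 : adm i *m (c *: ve) = 0 by rewrite -scalemxAr Ae scaler0.
rewrite Adx_vec A1 A2 ?mulmx0 // scaler0 addr0 scale1r.
by rewrite [x - _ - _]addrAC subrK.
Qed.

(** Here [b_2] and [b_8] are the root vectors of the short simple root and its negative, [b_0] is
    its coroot, and 2a - b is its value at [hvec a b]. *)
Lemma Adx_s1 a b :
  Adx (inord 2) 1 *m (Adx (inord 8) (- 1) *m (Adx (inord 2) 1 *m hvec a b))
    = hvec (b - a) b.
Proof.
rewrite (@Adx_reflection _ _ _ (evec 2) (evec 8) (evec 0) (a * 2 - b)).
- rewrite !hvecE addrAC -scalerBl; congr (_ *: _ + _); ring.
- rewrite hvecE mulmxDr -!scalemxAr (@adm_evec 2 0 2 (-2)) // (@adm_evec 2 1 2 1) //.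
  by rewrite !scalerA -scalerDl; congr (_ *: _); ring.
- by rewrite (@adm_evec 2 2 2 0) // scale0r.
- by rewrite (@adm_evec 2 0 2 (-2)) //.
- rewrite hvecE mulmxDr -!scalemxAr (@adm_evec 8 0 8 2) // (@adm_evec 8 1 8 (-1)) //.
  by rewrite !scalerA -scalerDl; congr (_ *: _); ring.
- by rewrite (@adm_evec 8 2 0 (-1)) // scaleN1r.
- by rewrite (@adm_evec 8 8 8 0) // scale0r.
- by rewrite (@adm_evec 8 0 8 2) //.
Qed.

(** The same for the long simple root, with root vectors [b_3], [b_9], coroot [b_1] and value 2b -
    3a. *)
Lemma Adx_s2 a b :
  Adx (inord 3) 1 *m (Adx (inord 9) (- 1) *m (Adx (inord 3) 1 *m hvec a b))
    = hvec a (a * 3 - b).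
Proof.
rewrite (@Adx_reflection _ _ _ (evec 3) (evec 9) (evec 1) (b * 2 - a * 3)).
- rewrite !hvecE -addrA -scalerBl; congr (_ + _ *: _); ring.
- rewrite hvecE mulmxDr -!scalemxAr (@adm_evec 3 0 3 3) // (@adm_evec 3 1 3 (-2)) //.
  by rewrite !scalerA -scalerDl; congr (_ *: _); ring.
- by rewrite (@adm_evec 3 3 3 0) // scale0r.
- by rewrite (@adm_evec 3 1 3 (-2)) //.
- rewrite hvecE mulmxDr -!scalemxAr (@adm_evec 9 0 9 (-3)) // (@adm_evec 9 1 9 2) //.
  by rewrite !scalerA -scalerDl; congr (_ *: _); ring.
- by rewrite (@adm_evec 9 3 1 (-1)) // scaleN1r.
- by rewrite (@adm_evec 9 9 9 0) // scale0r.
- by rewrite (@adm_evec 9 1 9 2) //.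
Qed.

End Adjoint.

Arguments adm {F} i.

(** * Invariant polynomial functions and their restriction to the Cartan subalgebra *)

Section InvariantDerivations.

Variable F : numFieldType.
Local Notation P15 := {mpoly F[15]}.
Implicit Types (x y : 'cV[F]_14) (a b c t z : F) (p q f : P15) (i : 'I_14).

Local Notation Y j := ('X_(lift ord0 j) : P15).
Local Notation toP := (@polyC F : {rmorphism F -> {poly F}}).
Local Notation toM := (@mpolyC 15 F : {rmorphism F -> P15}).

(** The k-th coordinate of [b_i, x] as a linear form in x. Thus [gD i] differentiates along the
    vector field x |-> [b_i, x] with z_0 fixed. *)
Definition adform i (k : 'I_14) : P15 := \sum_j adm i k j *: Y j.

Definition gD i p : P15 := \sum_k adform i k * p^`M(lift ord0 k).

Lemma gDD i : {morph gD i : p q / p + q}.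
Proof.
move=> p q; rewrite /gD -big_split; apply: eq_bigr => k _.
by rewrite mderivD mulrDr.
Qed.

Lemma gDM i p q : gD i (p * q) = gD i p * q + p * gD i q.
Proof.
rewrite /gD big_distrl big_distrr -big_split; apply: eq_bigr => k _.
by rewrite mderivM /=; ring.
Qed.

Lemma gDC i c : gD i c%:MP = 0.
Proof. by rewrite /gD big1 // => k _; rewrite mderivC mulr0. Qed.

Lemma gDZ i c p : gD i (c *: p) = c *: gD i p.
Proof. by rewrite -!mul_mpolyC gDM gDC mul0r add0r. Qed.

Lemma gD_z i : gD i 'X_ord0 = 0.
Proof. by rewrite /gD big1 // => k _; rewrite mderivXU mulr0. Qed.

Lemma gD_Y i k : gD i (Y k) = adform i k.
Proof.
rewrite /gD (bigD1 k) //= mderivXU eqxx mulr1 big1 ?addr0 // => j /negbTE jk.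
by rewrite mderivXU (inj_eq lift_inj) jk mulr0.
Qed.

Lemma gDN i p : gD i (- p) = - gD i p.
Proof. exact: (derivationN (@gDD i)). Qed.

Lemma gDX_eq0 i p k : gD i p = 0 -> gD i (p ^+ k) = 0.
Proof. exact: (derivation_exp_eq0 (@gDM i)). Qed.

Lemma gD_sum i I (r : seq I) (P : pred I) (G : I -> P15) :
  gD i (\sum_(j <- r | P j) G j) = \sum_(j <- r | P j) gD i (G j).
Proof. exact: (derivation_sum (@gDD i)). Qed.

Definition gM n (phi : 'I_14 -> 'M[F]_n) : 'M[P15]_n :=
  \sum_j Y j *: map_mx (fun c => c%:MP) (phi j).

(** The derivative of phi(x) along x |-> [b_i, x] is phi([b_i, x]), which is the commutator of
    phi(b_i) and phi(x). This is the hypothesis of the determinant and trace lemmas above. *)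
Lemma gD_gM n (phi : 'I_14 -> 'M[F]_n) i : is_rep phi ->
  map_mx (gD i) (gM phi) =
    map_mx toM (phi i) *m gM phi - gM phi *m map_mx toM (phi i).
Proof.
move=> hphi; rewrite /gM mulmx_sumr mulmx_suml -sumrB.
transitivity (\sum_j Y j *: map_mx toM (\sum_k (g2_sc i j k)%:~R *: phi k)); last first.
  apply: eq_bigr => j _.
  by rewrite -hphi -scalemxAr -scalemxAl map_mxB !map_mxM scalerBr.
apply/matrixP => a b; rewrite [LHS]mxE.
rewrite [X in gD i X]summxE [RHS]summxE gD_sum.
transitivity (\sum_j \sum_k Y k * (adm i j k * phi j a b)%:MP).
  apply: eq_bigr => j _; rewrite !mxE gDM gD_Y gDC mulr0 addr0 big_distrl.
  apply: eq_bigr => k _; rewrite /= -mul_mpolyC mpolyCM; ring.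
rewrite exchange_big; apply: eq_bigr => k _; rewrite mxE [in RHS]mxE summxE.
rewrite -big_distrr rmorph_sum; congr (_ * _); apply: eq_bigr => j _.
by rewrite !mxE.
Qed.

Lemma gD_det n (phi : 'I_14 -> 'M[F]_n) i : is_rep phi ->
  gD i (\det (('X_ord0 : P15)%:M + gM phi)) = 0.
Proof.
move=> hphi; apply: (derivation_det_eq0 (@gDD i) (@gDM i) (B := map_mx toM (phi i))).
rewrite mulmxDr mulmxDl scalar_mxC opprD addrACA subrr add0r.
rewrite -gD_gM //; apply/matrixP => a b; rewrite !mxE gDD.
suff -> : gD i ('X_ord0 *+ (a == b)) = 0 by rewrite add0r.
by case: eqP; rewrite ?mulr1n ?gD_z // mulr0n (derivation0 (@gDD i)).
Qed.

Lemma gD_tr_gM (phi : 'I_14 -> 'M[F]_14) i k : is_rep phi ->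
  gD i (\tr (gM phi ^+ k)) = 0.
Proof.
by move=> /gD_gM h; apply: (derivation_trX_eq0 (@gDD i) (@gDM i) _ (h _)).
Qed.

Definition zpt z x : 'I_15 -> F :=
  fun j => if unlift ord0 j is Some k then x k ord0 else z.

Lemma zptE z x k : zpt z x (lift ord0 k) = x k ord0.
Proof. by rewrite /zpt liftK. Qed.

Lemma zpt0 z x : zpt z x ord0 = z.
Proof. by rewrite /zpt unlift_none. Qed.

Lemma ord15P (P : 'I_15 -> Prop) : P ord0 -> (forall k, P (lift ord0 k)) -> forall j, P j.
Proof. by move=> P0 PS j; case: (unliftP ord0 j) => [k|] ->. Qed.

(* [t |-> exp (t ad b_i) x] as a polynomial curve. *)
Definition Ad_curve i z x (j : 'I_15) : {poly F} :=
  if unlift ord0 j is Some k then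
    \poly_(m < 14) ((adm i ^+ m *m x) k ord0 / (m`!)%:R) else z%:P.

Lemma Ad_curveE i z x t j : (Ad_curve i z x j).[t] = zpt z (Adx i t *m x) j.
Proof.
elim/ord15P: j => [|k]; rewrite /Ad_curve ?zptE ?zpt0 ?liftK ?unlift_none ?hornerC //.
rewrite horner_poly /Adx mulmx_suml summxE; apply: eq_bigr => m _.
by rewrite -scalemxAl [in RHS]mxE; ring.
Qed.

Lemma Adx0 i x : Adx i 0 *m x = x.
Proof.
rewrite /Adx mulmx_suml big_ord_recl big1 => [|m _].
  by rewrite addr0 expr0 fact0 divr1 scale1r expr0 mul1mx.
by rewrite lift0 expr0n /= mul0r scale0r mul0mx.
Qed.

(** The curve solves x' = [b_i, x], so the chain rule turns d/dt into [gD i]. *)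
Lemma deriv_Ad_curve i z x f : is_root_vector i ->
  (mmap toP (Ad_curve i z x) f)^`() = mmap toP (Ad_curve i z x) (gD i f).
Proof.
move=> hi.
(* Needed at the cut-off: differentiation shifts the coefficients of the truncated exponential by
   one, and nilpotency makes the missing terms 0. *)
have nil m : (3 < m)%N -> adm i ^+ m = 0 :> 'M[F]_14.
  by move=> m3; rewrite -(subnKC m3) exprD adm_nilp // mul0r.
rewrite (derivation_mmap _ _ (@derivD F) (@derivM F) (@derivC F)).
have d0 : (Ad_curve i z x ord0)^`() = 0 by rewrite /Ad_curve unlift_none derivC.
rewrite big_ord_recl d0 mulr0 add0r /gD rmorph_sum.
apply: eq_bigr => k _; rewrite rmorphM mulrC; congr (_ * _).
rewrite /adform rmorph_sum; apply/polyP => m; rewrite coef_sum coef_deriv.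
under eq_bigr => l _ do rewrite /= mmapZ mmapXU coefCM /Ad_curve liftK coef_poly.
rewrite /Ad_curve liftK coef_poly.
transitivity ((adm i ^+ m.+1 *m x) k ord0 / (m`!)%:R : F).
  have [m14|m14] := ltnP m.+1 14.
    by rewrite factS natrM invfM mulrA -[LHS]mulr_natr mulrAC divfK ?pnatr_eq0.
  by rewrite nil ?mul0mx ?mxE ?mul0r ?mul0rn //; lia.
have -> : (adm i ^+ m.+1 *m x) k ord0
    = \sum_l adm i k l * (adm i ^+ m *m x) l ord0.
  by rewrite exprS -mulmxE -mulmxA mxE.
rewrite big_distrl; apply: eq_bigr => l _; have [m14|m14] := ltnP m 14.
  by rewrite /= mulrA.
have -> : (adm i ^+ m *m x) l ord0 = 0 by rewrite nil ?mul0mx ?mxE //; lia.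
by rewrite /= !mulr0 mul0r.
Qed.

Lemma Ad_curve_const i z x f : is_root_vector i -> gD i f = 0 ->
  mmap toP (Ad_curve i z x) f = (f.@[zpt z x])%:P.
Proof.
move=> hi hf.
have /deriv_eq0_polyC e : (mmap toP (Ad_curve i z x) f)^`() = 0.
  by rewrite deriv_Ad_curve // hf rmorph0.
rewrite e; congr _%:P; rewrite -horner_coef0 horner_mmap.
by apply: meval_eq => j; rewrite Ad_curveE Adx0.
Qed.

Lemma gD_invariant i t z x f : is_root_vector i -> gD i f = 0 ->
  f.@[zpt z (Adx i t *m x)] = f.@[zpt z x].
Proof.
move=> hi hf; have := congr1 (horner^~ t) (Ad_curve_const z x hi hf).
rewrite hornerC horner_mmap => <-.
by apply: meval_eq => j; rewrite Ad_curveE.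
Qed.

(* Along the curve, [q r] is a nonzero constant, so [q] has degree 0 in [t]. *)
Lemma gD_factor_invariant i t z x q r : is_root_vector i -> gD i (q * r) = 0 ->
  (q * r).@[zpt z x] != 0 -> q.@[zpt z (Adx i t *m x)] = q.@[zpt z x].
Proof.
move=> hi hf f0; have := Ad_curve_const z x hi hf; rewrite rmorphM /=.
set g : {poly F} := mmap _ _ q; set g' : {poly F} := mmap _ _ r => e.
have gg0 : g * g' != 0 by rewrite e polyC_eq0.
have : size (g * g') = 1%N by rewrite e size_polyC f0.
move: gg0; rewrite mulf_eq0 negb_or => /andP[g0 g0'].
rewrite size_mul // => sz.
have /size1_polyC eg : (size g <= 1)%N.
  have sg : (0 < size g)%N by rewrite size_poly_gt0.
  have sg' : (0 < size g')%N by rewrite size_poly_gt0.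
  by move: sz sg sg'; case: (size g) => [|[|m]] //; case: (size g') => [|m'] //=; rewrite addnS.
have E s : g.[s] = q.@[zpt z (Adx i s *m x)].
  by rewrite /g horner_mmap; apply: meval_eq => j; rewrite Ad_curveE.
by rewrite -E -[in RHS](Adx0 i x) -E eg !hornerC.
Qed.

(** The indices below 3 are z_0 and the two coordinates on h. The target keeps all 15 variables, so
    that restriction commutes with the partial derivatives in these three directions. *)
Definition rho_var (j : 'I_15) : P15 := if (j < 3)%N then 'X_j else 0.

(* Restriction of polynomial functions from [C x g] to [C x h]. *)
Definition rho p : P15 := mmap toM rho_var p.

Lemma rho_var_mderiv (j k : 'I_15) : (j < 3)%N -> (rho_var k)^`M(j) = (j == k)%:R.
Proof.
move=> j3; rewrite /rho_var; case: ifP => k3; first by rewrite mderivXU.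
by rewrite mderiv0; case: eqP k3 => // <-; rewrite j3.
Qed.

Lemma rho_mderiv (j : 'I_15) p : (j < 3)%N -> (rho p)^`M(j) = rho p^`M(j).
Proof.
move=> j3; rewrite /rho (derivation_mmap _ _ (@mderivD _ _ j) (@mderivM _ _ j)); last first.
  by move=> c; exact: mderivC.
rewrite (bigD1 j) //= rho_var_mderiv // eqxx mulr1 big1 ?addr0 // => k kj.
by rewrite rho_var_mderiv // eq_sym (negbTE kj) mulr0.
Qed.

(** For h in the Cartan subalgebra [b_i, h] is minus the root at h times b_i, so a single partial
    derivative survives in [gD i]. *)
Lemma rho_gD i p : is_root_vector i ->
  rho (gD i p) = - ((rt 0 i)%:~R *: Y h1 + (rt 1 i)%:~R *: Y h2) * rho p^`M(lift ord0 i).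
Proof.
move=> hi; rewrite /rho /gD rmorph_sum (bigD1 i) //= rmorphM /=.
have H k : mmap toM rho_var (adform i k)
    = if k == i then - ((rt 0 i)%:~R *: Y h1 + (rt 1 i)%:~R *: Y h2) else 0.
  rewrite /adform rmorph_sum (bigD1 h1) //= (bigD1 h2) /=; last first.
    by rewrite -val_eqE /= val_h1 val_h2.
  rewrite big1 => [|l /andP[l1 l2]]; last first.
    rewrite mmapZ mmapXU /rho_var lift0; case: ifP => // l3; last by rewrite mulr0.
    by move: l1 l2; rewrite -!val_eqE /= val_h1 val_h2; lia.
  rewrite !mmapZ !mmapXU /rho_var !lift0 val_h1 val_h2 /= addr0 !mul_mpolyC.
  rewrite !mxE !(g2_scN i) g2_sc_h1 g2_sc_h2 eq_sym; case: eqP => _.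
    by rewrite !rmorphN /= !scaleNr opprD.
  by rewrite oppr0 !scale0r addr0.
rewrite H eqxx big1 ?addr0 // => k /negbTE ki.
by rewrite rmorphM /= H ki mul0r.
Qed.

Lemma meval_rho p v :
  (rho p).@[v] = p.@[zpt (v ord0) (hvec (v (lift ord0 h1)) (v (lift ord0 h2)))].
Proof.
rewrite meval_mmap; apply: meval_eq; apply: ord15P => [|k].
  by rewrite zpt0 /rho_var mevalXU.
rewrite zptE mxE /rho_var lift0 -!val_eqE /= val_h1 val_h2.
case: k => [[|[|k]] hk] //=; rewrite ?meval0 // mevalXU; congr (v _); apply/val_inj.
  by rewrite /= val_h1.
by rewrite /= val_h2.
Qed.

Lemma rho_eq0 p : (forall z a b, p.@[zpt z (hvec a b)] = 0) -> rho p = 0.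
Proof. by move=> h; apply: meval_eq0 => v; rewrite meval_rho. Qed.

Lemma mderiv_adform i k j :
  (adform i k)^`M(j) = (\sum_l adm i k l * (j == lift ord0 l)%:R)%:MP.
Proof.
rewrite /adform raddf_sum rmorph_sum; apply: eq_bigr => l _ /=.
by rewrite mderivZ mderivXU -mul_mpolyC mpolyCM rmorph_nat.
Qed.

Lemma gD_mderiv i j p :
  gD i p^`M(j) = (gD i p)^`M(j) - \sum_k (adform i k)^`M(j) * p^`M(lift ord0 k).
Proof.
rewrite /gD raddf_sum -sumrB; apply: eq_bigr => k _ /=.
by rewrite mderivM mderiv_comm [_ + adform _ _ * _]addrC addrK.
Qed.

(** A derivative of an invariant is in general not invariant, so the induction on degree runs over
    families stable under [gD i] whose members vanish on h. Their partial derivatives vanish on h as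
    well: along z_0 and h because restriction commutes with them, along b_i by [rho_gD], since a
    root is a nonzero linear form. *)
Lemma mderiv_family d (P : P15 -> Prop) :
  (forall p q, P p -> P q -> P (p + q)) -> (forall c p, P p -> P (c *: p)) ->
  P 0 -> (forall i p, is_root_vector i -> P p -> P (gD i p)) ->
  (forall p, P p -> rho p = 0) -> (forall p, P p -> (msize p <= d)%N) ->
  forall p, P p -> p = 0.
Proof.
elim: d P => [|d IH] P PD PZ P0 PG Prho Psz p Pp.
  by apply/eqP; rewrite -msize_poly_eq0; have := Psz _ Pp; lia.
have PB q q' : P q -> P q' -> P (q - q').
  by move=> hq hq'; apply: PD => //; rewrite -scaleN1r; apply: PZ.
(* Sums of derivatives of members, because [gD i] sends one partial derivative to a combination of
   several. *)
pose P' q := exists2 g : 'I_15 -> P15, (forall j, P (g j)) & q = \sum_j (g j)^`M(j).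
have rho_d q j : P q -> rho q^`M(j) = 0.
  move=> Pq; have [j3|j3] := ltnP j 3; first by rewrite -rho_mderiv // Prho // mderiv0.
  case: (unliftP ord0 j) j3 => [k|] ->; rewrite ?lift0 // ltnS => k2.
  have := rho_gD q k2; rewrite Prho; last exact: PG.
  move/esym/eqP; rewrite mulf_eq0 oppr_eq0 => /orP[|/eqP//].
  have n12 : h1 == h2 = false by rewrite -val_eqE /= val_h1 val_h2.
  move=> /eqP e; have := rt_neq0 k2.
  have /(congr1 (mderiv (lift ord0 h1))) := e; have /(congr1 (mderiv (lift ord0 h2))) := e.
  rewrite !mderivD !mderivZ !mderivXU !(inj_eq lift_inj) !eqxx eq_sym n12 !scaler0.
  rewrite addr0 add0r !mderiv0 -!mul_mpolyC !mulr1.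
  by move=> /eqP; rewrite mpolyC_eq0 intr_eq0 => ->; move=> /eqP; rewrite mpolyC_eq0 intr_eq0 => ->.
have P'0 q : P' q -> q = 0.
  apply: IH => {q}.
  - move=> q r [g hg ->] [g' hg' ->]; exists (fun j => g j + g' j); first by move=> j; apply: PD.
    by rewrite -big_split; apply: eq_bigr => j _; rewrite /= mderivD.
  - move=> c q [g hg ->]; exists (fun j => c *: g j); first by move=> j; apply: PZ.
    by rewrite scaler_sumr; apply: eq_bigr => j _; rewrite mderivZ.
  - by exists (fun=> 0) => //; rewrite big1 // => j _; rewrite mderiv0.
  - move=> i q hi [g hg ->].
    pose c k (j : 'I_15) := \sum_l adm i k l * (j == lift ord0 l)%:R : F.
    have cE k j : (adform i k)^`M(j) = (c k j)%:MP by exact: mderiv_adform.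
    (* Moving [gD i] past the partial derivatives leaves the derivatives of [g l] along b_k with
       constant coefficients [c k l]; these are collected by [k]. *)
    exists (fun j => gD i (g j) - (if unlift ord0 j is Some k then \sum_l c k l *: g l else 0)).
      move=> j; apply: PB; first exact: PG.
      case: (unlift _ _) => [k|//].
      by apply: (big_ind P) => // l _; apply: PZ.
    rewrite gD_sum; under eq_bigr do rewrite gD_mderiv.
    under [RHS]eq_bigr do rewrite mderivB.
    rewrite !sumrB; congr (_ - _); rewrite [RHS]big_ord_recl unlift_none mderiv0 add0r.
    rewrite exchange_big; apply: eq_bigr => k _; rewrite liftK raddf_sum.
    by apply: eq_bigr => l _; rewrite /= cE mul_mpolyC mderivZ.
  - move=> q [g hg ->]; rewrite /rho rmorph_sum big1 // => j _.
    exact: rho_d.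
  - move=> q [g hg ->]; apply: (big_ind (fun q => (msize q <= d)%N)).
    + by rewrite msize0.
    + by move=> r r' hr hr'; apply: leq_trans (msizeD_le _ _) _; rewrite geq_max hr hr'.
    + by move=> j _; have := msize_mderiv (g j) j; have := Psz _ (hg j); lia.
have dp j : p^`M(j) = 0.
  apply: P'0; exists (fun k => if k == j then p else 0); first by move=> k; case: ifP.
  rewrite (bigD1 j) //= eqxx big1 ?addr0 // => k /negbTE ->; exact: mderiv0.
have /mderiv_eq0_const e := dp; have := Prho _ Pp.
by rewrite e /rho mmapC.
Qed.

(* The Chevalley restriction map is injective. *)
Lemma invariant_eq p q :
  (forall i, is_root_vector i -> gD i p = 0) ->
  (forall i, is_root_vector i -> gD i q = 0) ->
  (forall z a b, p.@[zpt z (hvec a b)] = q.@[zpt z (hvec a b)]) -> p = q.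
Proof.
move=> hp hq e; apply/eqP; rewrite -subr_eq0; apply/eqP.
pose P r := [/\ forall i, is_root_vector i -> gD i r = 0, rho r = 0
              & (msize r <= msize (p - q))%N].
have g0 i : gD i 0 = 0 by exact: (derivation0 (@gDD i)).
apply: (@mderiv_family (msize (p - q)) P).
- move=> r r' [h1 h2 h3] [h1' h2' h3']; split.
  + by move=> i hi; rewrite gDD h1 // h1' // addr0.
  + by rewrite /rho rmorphD /= -/(rho r) -/(rho r') h2 h2' addr0.
  + by apply: leq_trans (msizeD_le _ _) _; rewrite geq_max h3 h3'.
- move=> c r [h1 h2 h3]; split.
  + by move=> i hi; rewrite gDZ h1 // scaler0.
  + by rewrite /rho mmapZ -/(rho r) h2 mulr0.
  + exact: leq_trans (msizeZ_le _ _) _.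
- by split=> //; rewrite ?msize0 // /rho rmorph0.
- by move=> i r hi [h1 h2 h3]; rewrite h1 //; split=> //; rewrite ?msize0 // /rho rmorph0.
- by move=> r [].
- by move=> r [].
split=> //; first by move=> i hi; rewrite gDD gDN hp // hq // subrr.
by apply: rho_eq0 => z a b; rewrite mevalB e subrr.
Qed.

End InvariantDerivations.

Lemma size_mmap_le (F : numFieldType) n (u : 'I_n -> {poly F}) (p : {mpoly F[n]}) :
  (forall i, (size (u i) <= 2)%N) ->
  (size (mmap (polyC : {rmorphism F -> {poly F}}) u p) <= msize p)%N.
Proof.
move=> hu; rewrite /mmap; apply: leq_trans (size_sum _ _ _) _.
apply/bigmax_leqP_seq => m hm _; rewrite mul_polyC.
apply: leq_trans (size_scale_leq _ _) _; apply: leq_trans (msize_mdeg_lt hm).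
rewrite mdegE /mmap1.
have M (p1 p2 : {poly F}) d1 d2 :
    (size p1 <= d1.+1)%N -> (size p2 <= d2.+1)%N -> (size (p1 * p2)%R <= (d1 + d2).+1)%N.
  by move=> s1 s2; apply: leq_trans (size_polyMleq _ _) _; lia.
apply: (big_ind2 (fun (x : {poly F}) d => (size x <= d.+1)%N)).
- by rewrite size_poly1.
- by move=> x1 d1 x2 d2; apply: M.
move=> i _; elim: (m i) => [|k IH]; first by rewrite expr0 size_poly1.
by rewrite exprS -[X in (_ <= X.+1)%N]addn1 addnC; apply: M => //; apply: hu.
Qed.

(** * Weyl invariance of factors, and irreducibility of a product over an orbit *)

Section Weights.

Variable F : numClosedFieldType.
Local Notation P15 := {mpoly F[15]}.
Local Notation wt := (F * F)%type.
Local Notation toP := (@polyC F : {rmorphism F -> {poly F}}).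
Local Notation toM := (@mpolyC 15 F : {rmorphism F -> P15}).
Implicit Types (x y : 'cV[F]_14) (a b c t z : F) (p q r f : P15) (i : 'I_14) (nu mu : wt).

Definition wval nu a b : F := a * nu.1 + b * nu.2.
(** The simple reflections nu - nu(h_k) alpha_k written out, with alpha_1 = (2, -1) and alpha_2 =
    (-3, 2). *)
Definition wref1 nu : wt := (- nu.1, nu.1 + nu.2).
Definition wref2 nu : wt := (nu.1 + 3 * nu.2, - nu.2).

Lemma wval_ref1 nu a b : wval (wref1 nu) a b = wval nu (b - a) b.
Proof. by rewrite /wval /=; ring. Qed.

Lemma wval_ref2 nu a b : wval (wref2 nu) a b = wval nu a (a * 3 - b).
Proof. by rewrite /wval /=; ring. Qed.

Lemma wref1K : involutive wref1.
Proof. by case=> a b; rewrite /wref1 /=; congr (_, _); ring. Qed.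

Lemma wref2K : involutive wref2.
Proof. by case=> a b; rewrite /wref2 /=; congr (_, _); ring. Qed.

(** Two distinct weights agree at h_1 + t h_2 for at most one t. The polynomial [P] vanishes exactly
    at these bad values for pairs from [L]. *)
Lemma wval_separation (L : seq wt) : exists t, {in L &, injective (fun nu => wval nu 1 t)}.
Proof.
pose P : {poly F} := \prod_(n1 <- L) \prod_(n2 <- L | n1 != n2)
  ((n1.1 - n2.1)%:P + (n1.2 - n2.2) *: 'X).
have : P != 0.
  rewrite prodf_seq_neq0; apply/allP => n1 _ /=; rewrite prodf_seq_neq0.
  apply/allP => n2 _; apply/implyP; apply: contra_neq => e.
  have := congr1 (fun p : {poly F} => p`_0) e; have := congr1 (fun p : {poly F} => p`_1) e.
  rewrite !coefD !coefC !coefZ !coefX /= mulr1 mulr0 add0r addr0.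
  move=> /eqP; rewrite subr_eq0 => /eqP h2 /eqP; rewrite subr_eq0 => /eqP h1.
  by case: n1 n2 h1 h2 {e} => [? ?] [? ?] /= -> ->.
move=> /closed_nonrootP[t]; rewrite rootE => ht; exists t => n1 n2 h1 h2 e.
apply/eqP; apply: contraNT ht => n12; rewrite /P horner_prod.
rewrite (big_rem n1) //= horner_prod (big_rem n2) //= n12 !hornerE mulf_eq0; apply/orP; left.
rewrite mulf_eq0; apply/orP; left.
move: e; rewrite /wval !mul1r => /eqP; rewrite -subr_eq0 => /eqP <-.
by apply/eqP; ring.
Qed.

Definition invariant f := forall i, is_root_vector i -> gD i f = 0.

Lemma root2 : is_root_vector (inord 2). Proof. by rewrite /is_root_vector inordK. Qed.
Lemma root3 : is_root_vector (inord 3). Proof. by rewrite /is_root_vector inordK. Qed.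
Lemma root8 : is_root_vector (inord 8). Proof. by rewrite /is_root_vector inordK. Qed.
Lemma root9 : is_root_vector (inord 9). Proof. by rewrite /is_root_vector inordK. Qed.

Lemma invariant_s1 f z a b : invariant f ->
  f.@[zpt z (hvec (b - a) b)] = f.@[zpt z (hvec a b)].
Proof.
move=> hf; rewrite -Adx_s1.
by rewrite !gD_invariant // ?hf // ?root2 ?root8.
Qed.

Lemma invariant_s2 f z a b : invariant f ->
  f.@[zpt z (hvec a (a * 3 - b))] = f.@[zpt z (hvec a b)].
Proof.
move=> hf; rewrite -Adx_s2.
by rewrite !gD_invariant // ?hf // ?root3 ?root9.
Qed.

(** A factor is known to be constant along an exponential only where the product is nonzero.
    Invariance of the product carries nonvanishing through the three exponentials that make up the
    reflection. *)
Lemma factor_s1 q r z a b : invariant (q * r) -> (q * r).@[zpt z (hvec a b)] != 0 ->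
  q.@[zpt z (hvec (b - a) b)] = q.@[zpt z (hvec a b)].
Proof.
move=> hf f0; rewrite -Adx_s1.
have fi i t x : is_root_vector i -> (q * r).@[zpt z x] != 0 ->
    (q * r).@[zpt z (Adx i t *m x)] != 0.
  by move=> hi; rewrite gD_invariant // hf.
have [re rf] := (root2, root8).
have n1 := fi _ 1 _ re f0; have n2 := fi _ (- 1) _ rf n1.
rewrite (gD_factor_invariant _ re (hf _ re) n2) (gD_factor_invariant _ rf (hf _ rf) n1).
by rewrite (gD_factor_invariant _ re (hf _ re) f0).
Qed.

Lemma factor_s2 q r z a b : invariant (q * r) -> (q * r).@[zpt z (hvec a b)] != 0 ->
  q.@[zpt z (hvec a (a * 3 - b))] = q.@[zpt z (hvec a b)].
Proof.
move=> hf f0; rewrite -Adx_s2.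
have fi i t x : is_root_vector i -> (q * r).@[zpt z x] != 0 ->
    (q * r).@[zpt z (Adx i t *m x)] != 0.
  by move=> hi; rewrite gD_invariant // hf.
have [re rf] := (root3, root9).
have n1 := fi _ 1 _ re f0; have n2 := fi _ (- 1) _ rf n1.
rewrite (gD_factor_invariant _ re (hf _ re) n2) (gD_factor_invariant _ rf (hf _ rf) n1).
by rewrite (gD_factor_invariant _ re (hf _ re) f0).
Qed.

(** Restriction to the line on which h is fixed and z_0 varies; a product over weights becomes a
    monic polynomial there. *)
Definition zline_var a b (j : 'I_15) : {poly F} :=
  if unlift ord0 j is Some k then (hvec a b k ord0)%:P else 'X.

Definition zline a b q : {poly F} := mmap toP (zline_var a b) q.

Lemma horner_zline a b q z : (zline a b q).[z] = q.@[zpt z (hvec a b)].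
Proof.
rewrite /zline horner_mmap; apply: meval_eq; apply: ord15P => [|k].
  by rewrite zpt0 /zline_var unlift_none hornerX.
by rewrite zptE /zline_var liftK hornerC.
Qed.

Lemma zlineM a b q r : zline a b (q * r) = zline a b q * zline a b r.
Proof. by rewrite /zline rmorphM. Qed.

Lemma size_zline a b q : (size (zline a b q) <= msize q)%N.
Proof.
apply: size_mmap_le; apply: ord15P => [|k]; rewrite /zline_var ?unlift_none ?size_polyX //.
by rewrite liftK (leq_trans (size_polyC_leq1 _)).
Qed.

Lemma eq_poly_horner (p1 p2 : {poly F}) : (forall z, p1.[z] = p2.[z]) -> p1 = p2.
Proof.
move=> h; apply/eqP; rewrite -subr_eq0; apply/eqP/poly_horner_eq0 => z.
by rewrite hornerD hornerN h subrr.
Qed.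

Definition wprod (L : seq wt) z a b : F := \prod_(nu <- L) (z + wval nu a b).

Lemma zline_wprod (L : seq wt) f a b :
  (forall z, f.@[zpt z (hvec a b)] = wprod L z a b) ->
  zline a b f = \prod_(nu <- L) ('X - (- wval nu a b)%:P).
Proof.
move=> h; apply: eq_poly_horner => z; rewrite horner_zline h horner_prod.
by apply: eq_bigr => nu _; rewrite hornerXsubC opprK.
Qed.

Lemma zline_wprod_neq0 (L : seq wt) f a b :
  (forall z, f.@[zpt z (hvec a b)] = wprod L z a b) -> zline a b f != 0.
Proof.
by move=> h; rewrite (zline_wprod h) monic_neq0 // monic_prod_XsubC.
Qed.

Lemma msize_wprod (L : seq wt) f : (forall z a b, f.@[zpt z (hvec a b)] = wprod L z a b) ->
  (size L < msize f)%N.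
Proof.
move=> h; have := size_zline 0 0 f; rewrite (@zline_wprod L) //.
by rewrite -(big_map (fun nu => - wval nu 0 0) predT (fun c => 'X - c%:P)) size_prod_XsubC size_map.
Qed.

(** The restriction of [q * r] to each such line is a nonzero polynomial, so it can be cancelled;
    this removes the nonvanishing condition of [factor_s1]. *)
Lemma factor_s1_all (L : seq wt) q r z a b : invariant (q * r) ->
  (forall z a b, (q * r).@[zpt z (hvec a b)] = wprod L z a b) ->
  q.@[zpt z (hvec (b - a) b)] = q.@[zpt z (hvec a b)].
Proof.
move=> hf hL; rewrite -!horner_zline; congr (_.[_]).
apply/eqP; rewrite -subr_eq0; apply/eqP.
have f0 := zline_wprod_neq0 (fun z => hL z a b).
apply: (mulfI f0); rewrite mulr0; apply: poly_horner_eq0 => w.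
rewrite hornerM hornerD hornerN !horner_zline.
have [-> |n0] := eqVneq ((q * r).@[zpt w (hvec a b)]) 0; first by rewrite mul0r.
by rewrite (factor_s1 hf n0) subrr mulr0.
Qed.

Lemma factor_s2_all (L : seq wt) q r z a b : invariant (q * r) ->
  (forall z a b, (q * r).@[zpt z (hvec a b)] = wprod L z a b) ->
  q.@[zpt z (hvec a (a * 3 - b))] = q.@[zpt z (hvec a b)].
Proof.
move=> hf hL; rewrite -!horner_zline; congr (_.[_]).
apply/eqP; rewrite -subr_eq0; apply/eqP.
have f0 := zline_wprod_neq0 (fun z => hL z a b).
apply: (mulfI f0); rewrite mulr0; apply: poly_horner_eq0 => w.
rewrite hornerM hornerD hornerN !horner_zline.
have [-> |n0] := eqVneq ((q * r).@[zpt w (hvec a b)]) 0; first by rewrite mul0r.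
by rewrite (factor_s2 hf n0) subrr mulr0.
Qed.

Definition vanishes_on q nu := forall a b, q.@[zpt (- wval nu a b) (hvec a b)] = 0.

(** Parametrizes the hyperplane z_0 = - nu(h) of C x h. Vanishing there becomes membership in the
    kernel of a ring morphism into a domain, so it passes to one of two factors. *)
Definition hyp_var nu (j : 'I_15) : P15 :=
  if unlift ord0 j is Some k then
    if k == h1 then 'X_(lift ord0 h1) else if k == h2 then 'X_(lift ord0 h2) else 0
  else - (nu.1 *: 'X_(lift ord0 h1) + nu.2 *: 'X_(lift ord0 h2)).

Lemma vanishes_onP q nu : vanishes_on q nu <-> mmap toM (hyp_var nu) q = 0.
Proof.
have H v : (mmap toM (hyp_var nu) q).@[v] =
    q.@[zpt (- wval nu (v (lift ord0 h1)) (v (lift ord0 h2)))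
           (hvec (v (lift ord0 h1)) (v (lift ord0 h2)))].
  rewrite meval_mmap; apply: meval_eq; apply: ord15P => [|k].
    rewrite zpt0 /hyp_var unlift_none mevalN mevalD !mevalZ !mevalXU /wval.
    by rewrite mulrC [_ * v _]mulrC.
  rewrite zptE /hyp_var liftK mxE; case: eqP => _; first by rewrite mevalXU.
  by case: eqP => _; rewrite ?mevalXU ?meval0.
split=> [h|h a b]; first by apply: meval_eq0 => v; rewrite H.
have n12 : (h2 == h1) = false by rewrite -val_eqE /= val_h1 val_h2.
have := H (fun j => if j == lift ord0 h1 then a else b).
by rewrite h meval0 eqxx (inj_eq lift_inj) n12.
Qed.

Lemma vanishes_onM q r nu : vanishes_on (q * r) nu -> vanishes_on q nu \/ vanishes_on r nu.
Proof.
move=> /vanishes_onP; rewrite rmorphM /= => /eqP; rewrite mulf_eq0.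
by case/orP => /eqP h; [left|right]; apply/vanishes_onP.
Qed.

(** Says that [L] lies in the Weyl orbit of [mu], in the form of an induction principle over simple
    reflections. *)
Definition weyl_connected mu (L : seq wt) := forall P : wt -> Prop,
  P mu -> (forall nu, P nu -> P (wref1 nu) /\ P (wref2 nu)) -> forall nu, nu \in L -> P nu.

(** Weyl invariance spreads the vanishing of [q] to the hyperplanes of all weights in [L]. For an h
    that separates [L] these give [size L] distinct roots of a nonzero polynomial in z_0. *)
Lemma vanishes_msize (L : seq wt) mu q r : invariant (q * r) ->
  (forall z a b, (q * r).@[zpt z (hvec a b)] = wprod L z a b) ->
  uniq L -> weyl_connected mu L -> vanishes_on q mu -> (size L < msize q)%N.
Proof.
move=> hf hL uL cL hmu.
have hq nu : nu \in L -> vanishes_on q nu.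
  apply: cL => // {}nu h; split=> a b.
    by rewrite wval_ref1 -(factor_s1_all _ _ _ hf hL).
  by rewrite wval_ref2 -(factor_s2_all _ _ _ hf hL).
have [t tP] := wval_separation L.
apply: leq_trans (size_zline 1 t q).
have := @max_poly_roots _ (zline 1 t q) [seq - wval nu 1 t | nu <- L].
rewrite size_map; apply.
- have := zline_wprod_neq0 (fun z => hL z 1 t).
  by rewrite zlineM mulf_eq0 negb_or => /andP[].
- by apply/allP => _ /mapP[nu hnu ->]; rewrite rootE horner_zline hq.
by rewrite map_inj_in_uniq // => n1 n2 h1 h2 /oppr_inj; apply: tP.
Qed.

Lemma wprod_irreducible (L : seq wt) mu f q r : invariant f ->
  (forall z a b, f.@[zpt z (hvec a b)] = wprod L z a b) ->
  uniq L -> mu \in L -> weyl_connected mu L -> (msize f <= (size L).+1)%N ->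
  f = q * r -> q \is a GRing.unit \/ r \is a GRing.unit.
Proof.
move=> hf hL uL muL cL szf e.
have f0 : f != 0.
  by apply: contra_neq (zline_wprod_neq0 (fun z => hL z 0 0)) => ->; rewrite /zline rmorph0.
have [q0 r0] : q != 0 /\ r != 0 by apply/andP; rewrite -negb_or -mulf_eq0 -e.
have unit p : p != 0 -> (msize p <= 1)%N -> p \is a GRing.unit.
  move=> p0 /msize1_polyC ep; rewrite ep in p0 *.
  by apply: rmorph_unit; rewrite unitfE -(mpolyC_eq0 15).
have hv : vanishes_on (q * r) mu.
  by move=> a b; rewrite -e hL /wprod (big_rem mu) //= addNr mul0r.
have sz : (msize q + msize r).-1 = msize f by rewrite e msizeM.
have gt0 p : p != 0 -> (0 < msize p)%N by rewrite -msize_poly_eq0 lt0n.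
have := gt0 _ q0; have := gt0 _ r0 => rgt qgt.
rewrite e in hf; have hL' z a b : (q * r).@[zpt z (hvec a b)] = wprod L z a b by rewrite -e.
case: (vanishes_onM hv) => h.
  right; apply: unit => //; have := vanishes_msize hf hL' uL cL h.
  by lia.
left; apply: unit => //; rewrite mulrC in hf.
have hL2 z a b : (r * q).@[zpt z (hvec a b)] = wprod L z a b by rewrite mulrC.
by have := vanishes_msize hf hL2 uL cL h; lia.
Qed.

End Weights.

(** * Degree bounds *)

Section Degree.

Variables (F : numFieldType) (n : nat).
Implicit Types p q : {mpoly F[n]}.

Definition deg_le d p := (msize p <= d.+1)%N.

Lemma deg_leD d p q : deg_le d p -> deg_le d q -> deg_le d (p + q).
Proof.
rewrite /deg_le => hp hq; apply: leq_trans (msizeD_le _ _) _.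
by rewrite geq_max hp hq.
Qed.

Lemma deg_le0 d : deg_le d 0.
Proof. by rewrite /deg_le msize0. Qed.

Lemma deg_leM d1 d2 p q : deg_le d1 p -> deg_le d2 q -> deg_le (d1 + d2) (p * q).
Proof.
have [-> _ _|p0] := eqVneq p 0; first by rewrite mul0r deg_le0.
have [-> _ _|q0] := eqVneq q 0; first by rewrite mulr0 deg_le0.
rewrite /deg_le msizeM // => hp hq; have := leq_add hp hq.
by rewrite addSn addnS -subn1 leq_subLR add1n.
Qed.

Lemma deg_leX d k p : deg_le d p -> deg_le (d * k) (p ^+ k).
Proof.
move=> hp; elim: k => [|k IH]; first by rewrite muln0 expr0 /deg_le msize1.
by rewrite mulnS exprS deg_leM.
Qed.

Lemma deg_leZ d c p : deg_le d p -> deg_le d (c *: p).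
Proof. by move=> hp; apply: leq_trans (msizeZ_le _ _) _. Qed.

Lemma deg_leN d p : deg_le d p -> deg_le d (- p).
Proof. by rewrite -scaleN1r; exact: deg_leZ. Qed.

Lemma deg_leXU i : deg_le 1 ('X_i : {mpoly F[n]}).
Proof. by rewrite /deg_le msizeX mdeg1. Qed.

Lemma deg_le_sum d I (r : seq I) (P : pred I) (G : I -> {mpoly F[n]}) :
  (forall i, P i -> deg_le d (G i)) -> deg_le d (\sum_(i <- r | P i) G i).
Proof.
by move=> h; apply: (big_ind (deg_le d)) => //; [exact: deg_le0|exact: deg_leD].
Qed.

Lemma deg_le_trX m (M : 'M[{mpoly F[n]}]_m.+1) k :
  (forall i j, deg_le 1 (M i j)) -> deg_le k (\tr (M ^+ k)).
Proof.
move=> hM; apply: deg_le_sum => i _.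
suff : forall i j, deg_le k ((M ^+ k) i j) by [].
elim: k => [|k IH] {}i j.
  by rewrite expr0 mxE; case: eqP => _; rewrite ?deg_le0 // /deg_le msize1.
by rewrite exprS mxE; apply: deg_le_sum => l _; rewrite -add1n deg_leM.
Qed.

End Degree.

(** * Explicit orbital factors from traces of powers of ad x *)

Section OrbitalFactors.

Variable F : numClosedFieldType.
Local Notation P15 := {mpoly F[15]}.
Local Notation wt := (F * F)%type.
Implicit Types (a b c t z : F) (p q r f : P15) (i : 'I_14) (nu mu : wt).

Lemma diag_mxX n (d : 'rV[F]_n.+1) k : diag_mx d ^+ k = diag_mx (map_mx (fun c => c ^+ k) d).
Proof.
elim: k => [|k IH].
  rewrite expr0 -[1]/(1%:M) -diag_const_mx; congr diag_mx.
  by apply/matrixP => i j; rewrite !mxE expr0.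
rewrite exprS IH -mulmxE mulmx_diag; congr diag_mx.
by apply/matrixP => i j; rewrite (ord1 i) !mxE -exprS.
Qed.

Definition trX k : P15 := \tr (gM adm ^+ k).

Lemma trX_invariant k : invariant (trX k).
Proof. by move=> i _; apply: gD_tr_gM; exact: adm_rep. Qed.

Lemma trX_deg k : deg_le k (trX k).
Proof.
apply: deg_le_trX => i j; rewrite /gM summxE; apply: deg_le_sum => l _.
by rewrite !mxE mulrC mul_mpolyC; apply/deg_leZ/deg_leXU.
Qed.

(** On h the matrix of ad x is diagonal, with two zeros and the values of the roots, so its traces
    are power sums. *)
Lemma trX_h k z a b : (trX k).@[zpt z (hvec a b)] =
  \sum_(j < 14) (a * (rt 0 j)%:~R + b * (rt 1 j)%:~R) ^+ k.
Proof.
rewrite /trX -trace_map_mx rmorphXn /=.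
have -> : map_mx (meval (zpt z (hvec a b))) (gM adm)
    = diag_mx (\row_j (a * (rt 0 j)%:~R + b * (rt 1 j)%:~R)).
  apply/matrixP => i j; rewrite mxE /gM summxE rmorph_sum /=.
  under eq_bigr => l _ do rewrite !mxE mevalM mevalXU zptE mevalC mxE.
  have n12 : (h2 == h1) = false by rewrite -val_eqE /= val_h1 val_h2.
  rewrite (bigD1 h1) //= (bigD1 h2) /= ?n12 // !eqxx big1 => [|l /andP[l1 l2]]; last first.
    by rewrite (negbTE l1) (negbTE l2) mul0r.
  rewrite addr0 g2_sc_h1 g2_sc_h2 !mxE eq_sym.
  by case: eqP => [->|_]; rewrite ?mulr1n // mulr0n !mulr0 addr0.
rewrite diag_mxX mxtrace_diag; apply: eq_bigr => j _; by rewrite !mxE.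
Qed.

Lemma sum_rt (G : int -> int -> F) : \sum_(j < 14) G (rt 0 j) (rt 1 j) =
  \sum_(u <- [:: (0, 0); (0, 0); (2, -1); (-3, 2); (-1, 1); (1, 0); (3, -1); (0, 1);
    (-2, 1); (3, -2); (1, -1); (-1, 0); (-3, 1); (0, -1)] : seq (int * int)) G u.1 u.2.
Proof.
rewrite -(big_mkord xpredT (fun j => G (rt 0 j) (rt 1 j))) /index_iota subn0.
rewrite -(big_map (fun j => (rt 0 j, rt 1 j)) xpredT (fun u : int * int => G u.1 u.2)).
by congr bigop; vm_compute.
Qed.

(* With [x1, x2, x3] the short weights [a, a - b, b - 2 a] of sum 0, [e2 a b] and
   [e3 a b] are their elementary symmetric functions and [disc a b] is the
   product of their differences. *)
Definition e2 a b : F := - (a ^+ 2 * 3) + a * b * 3 - b ^+ 2.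
Definition e3 a b : F := a * (a - b) * (b - a * 2).
Definition disc a b : F := b * (a * 3 - b * 2) * (b - a * 3).

(** The discriminant of X^3 + e2 X - e3, the cubic with roots x1, x2, x3. *)
Lemma disc_sqr a b : disc a b ^+ 2 = - (e2 a b ^+ 3 * 4) - e3 a b ^+ 2 * 27.
Proof. by rewrite /disc /e2 /e3; ring. Qed.

Lemma trX2_h z a b : (trX 2).@[zpt z (hvec a b)] = - (16 * e2 a b).
Proof.
rewrite trX_h (sum_rt (fun u v => (a * u%:~R + b * v%:~R) ^+ 2)) !big_cons big_nil /e2 /=.
by ring.
Qed.

Lemma trX6_h z a b :
  (trX 6).@[zpt z (hvec a b)] = - (136 * e2 a b ^+ 3) - 156 * e3 a b ^+ 2.
Proof.
rewrite trX_h (sum_rt (fun u v => (a * u%:~R + b * v%:~R) ^+ 6)) !big_cons big_nil /e2 /e3 /=.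
by ring.
Qed.

(** The constants invert [trX2_h], [trX6_h] and [disc_sqr], so that [E2], [S3], [Dsc] restrict to
    e2, e3^2, disc^2. Squares are taken because e3 changes sign under the first simple reflection
    and disc under the second. *)
Definition E2 : P15 := (- 16^-1) *: trX 2.
Definition S3 : P15 := (- 156^-1) *: (trX 6 + 136 *: E2 ^+ 3).
Definition Dsc : P15 := - (4 *: E2 ^+ 3) - 27 *: S3.

Lemma E2_h z a b : E2.@[zpt z (hvec a b)] = e2 a b.
Proof. by rewrite mevalZ trX2_h; field. Qed.

Lemma S3_h z a b : S3.@[zpt z (hvec a b)] = e3 a b ^+ 2.
Proof. by rewrite /S3 mevalZ mevalD (mevalZ _ _ (E2 ^+ 3)) rmorphXn /= trX6_h E2_h; field. Qed.

Lemma Dsc_h z a b : Dsc.@[zpt z (hvec a b)] = disc a b ^+ 2.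
Proof.
rewrite /Dsc mevalB mevalN (mevalZ _ _ (E2 ^+ 3)) (mevalZ _ _ S3) rmorphXn /= E2_h S3_h.
by rewrite disc_sqr; ring.
Qed.

Lemma invariantD p q : invariant p -> invariant q -> invariant (p + q).
Proof. by move=> hp hq i hi; rewrite gDD hp // hq // addr0. Qed.

Lemma invariantM p q : invariant p -> invariant q -> invariant (p * q).
Proof. by move=> hp hq i hi; rewrite gDM hp // hq // mul0r mulr0 addr0. Qed.

Lemma invariantX p k : invariant p -> invariant (p ^+ k).
Proof. by move=> hp i hi; apply: gDX_eq0; apply: hp. Qed.

Lemma invariantZ c p : invariant p -> invariant (c *: p).
Proof. by move=> hp i hi; rewrite gDZ hp // scaler0. Qed.

Lemma invariantN p : invariant p -> invariant (- p).
Proof. by rewrite -scaleN1r; exact: invariantZ. Qed.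

Lemma invariant_z : invariant ('X_ord0 : P15).
Proof. by move=> i _; exact: gD_z. Qed.

Lemma E2_invariant : invariant E2.
Proof. by apply: invariantZ; exact: trX_invariant. Qed.

Lemma S3_invariant : invariant S3.
Proof.
apply: invariantZ; apply: invariantD; first exact: trX_invariant.
exact/invariantZ/invariantX/E2_invariant.
Qed.

Lemma Dsc_invariant : invariant Dsc.
Proof.
by apply: invariantD; apply: invariantN; apply: invariantZ;
  [apply/invariantX/E2_invariant|exact: S3_invariant].
Qed.

Lemma E2_deg : deg_le 2 E2.
Proof. by apply: deg_leZ; exact: trX_deg. Qed.

Lemma S3_deg : deg_le 6 S3.
Proof.
apply/deg_leZ/deg_leD; first exact: trX_deg.
by apply: deg_leZ; exact: (@deg_leX _ _ 2 3 _ E2_deg).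
Qed.

Lemma Dsc_deg : deg_le 6 Dsc.
Proof.
apply: deg_leD; apply: deg_leN; apply: deg_leZ; last exact: S3_deg.
exact: (@deg_leX _ _ 2 3 _ E2_deg).
Qed.

(* The three weights of the orbit of [mu] in a coset of the rotations of order 3
   have sum 0, second symmetric function [cQ mu * e2] and product
   [cA mu * e3 + cB mu * disc] or [cA mu * e3 - cB mu * disc]. *)
Definition cQ mu : F := mu.1 ^+ 2 + mu.1 * mu.2 * 3 + mu.2 ^+ 2 * 3.
Definition cA mu : F := mu.1 * (mu.1 + mu.2 * 3) * (mu.1 * 2 + mu.2 * 3) / 2.
Definition cB mu : F := mu.2 * (mu.1 + mu.2 * 2) * (mu.1 + mu.2) / 2.

Definition fX mu : P15 := ('X_ord0 ^+ 3 + cQ mu *: (E2 * 'X_ord0)) ^+ 2.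
(** With X = z^3 + cQ e2 z, the twelve linear factors multiply to the product of X^2 - (cA e3 + cB
    disc)^2 and X^2 - (cA e3 - cB disc)^2. [f12] rewrites this product in terms of e3^2 and disc^2.
    If [cA] or [cB] is 0, both halves coincide with [f6]. *)
Definition f6 mu : P15 := fX mu - cA mu ^+ 2 *: S3 - cB mu ^+ 2 *: Dsc.
Definition f12 mu : P15 := f6 mu ^+ 2 - (4 * cA mu ^+ 2 * cB mu ^+ 2) *: (S3 * Dsc).

(** The cases are the orbit sizes 1, 6 and 12 of a dominant weight, which lies on a wall exactly
    when a coordinate is 0. *)
Definition f_mu mu : P15 :=
  if (mu.1 == 0) && (mu.2 == 0) then 'X_ord0
  else if (mu.1 == 0) || (mu.2 == 0) then f6 mu else f12 mu.

Lemma f6_invariant mu : invariant (f6 mu).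
Proof.
apply: invariantD; [apply: invariantD|apply/invariantN/invariantZ/Dsc_invariant].
  apply: invariantX; apply: invariantD; first exact/invariantX/invariant_z.
  apply: invariantZ; apply: invariantM; [exact: E2_invariant|exact: invariant_z].
exact/invariantN/invariantZ/S3_invariant.
Qed.

Lemma f_mu_invariant mu : invariant (f_mu mu).
Proof.
rewrite /f_mu; case: ifP => _; first exact: invariant_z.
case: ifP => _; first exact: f6_invariant.
apply: invariantD; first exact/invariantX/f6_invariant.
by apply: invariantN; apply: invariantZ; apply: invariantM;
  [exact: S3_invariant|exact: Dsc_invariant].
Qed.

Lemma f6_deg mu : deg_le 6 (f6 mu).
Proof.
apply: deg_leD; [apply: deg_leD|apply/deg_leN/deg_leZ/Dsc_deg].
  apply: (@deg_leX _ _ 3 2); apply: deg_leD; first exact: (@deg_leX _ _ 1 3 _ (deg_leXU _ _)).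
  by apply/deg_leZ/(@deg_leM _ _ 2 1); [exact: E2_deg|exact: deg_leXU].
exact/deg_leN/deg_leZ/S3_deg.
Qed.

Lemma f12_deg mu : deg_le 12 (f12 mu).
Proof.
apply: deg_leD; first exact: (@deg_leX _ _ 6 2 _ (f6_deg mu)).
by apply/deg_leN/deg_leZ/(@deg_leM _ _ 6 6); [exact: S3_deg|exact: Dsc_deg].
Qed.

Lemma f6_h mu z a b : (f6 mu).@[zpt z (hvec a b)] =
  (z ^+ 3 + cQ mu * (e2 a b * z)) ^+ 2 - cA mu ^+ 2 * e3 a b ^+ 2 - cB mu ^+ 2 * disc a b ^+ 2.
Proof.
rewrite /f6 /fX !mevalB (mevalZ _ _ S3) (mevalZ _ _ Dsc) rmorphXn /= mevalD rmorphXn /=.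
by rewrite (mevalZ _ _ (E2 * _)) (mevalM _ E2) !mevalXU zpt0 E2_h S3_h Dsc_h.
Qed.

Lemma f12_h mu z a b : (f12 mu).@[zpt z (hvec a b)] =
  ((z ^+ 3 + cQ mu * (e2 a b * z)) ^+ 2 - (cA mu * e3 a b + cB mu * disc a b) ^+ 2) *
  ((z ^+ 3 + cQ mu * (e2 a b * z)) ^+ 2 - (cA mu * e3 a b - cB mu * disc a b) ^+ 2).
Proof.
rewrite /f12 mevalB rmorphXn /= (mevalZ _ _ (S3 * Dsc)) (mevalM _ S3) f6_h S3_h Dsc_h.
by ring.
Qed.

End OrbitalFactors.

(** * Weyl orbits of integral weights as explicit lists *)

Definition orb12 (A : pzRingType) (m : A * A) : seq (A * A) :=
  let: (x, y) := m in
  [:: (x, y); (- x, x + y); (x + x + (y + y + y), - x - y);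
      (- (x + x + (y + y + y)), x + (y + y)); (x + (y + y + y), - x - (y + y));
      (- x - (y + y + y), y);
      (- x, - y); (x, - x - y); (- (x + x + (y + y + y)), x + y);
      (x + x + (y + y + y), - x - (y + y)); (- x - (y + y + y), x + (y + y));
      (x + (y + y + y), - y)].

Definition orb6s (A : pzRingType) (x : A) : seq (A * A) :=
  [:: (x, 0); (- x, x); (x + x, - x); (- x, 0); (x, - x); (- (x + x), x)].

Definition orb6l (A : pzRingType) (y : A) : seq (A * A) :=
  [:: (0, y); (y + y + y, - y); (- (y + y + y), y + y);
      (0, - y); (- (y + y + y), y); (y + y + y, - (y + y))].

Section IntegralOrbits.

Implicit Types (x y : int) (m : nat).

Lemma orb12_uniq m1 m2 : (0 < m1)%N -> (0 < m2)%N -> uniq (orb12 (m1 : int, m2 : int)).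
Proof.
by move=> h1 h2; rewrite /orb12 /= !inE !xpair_eqE; repeat (apply/andP; split); lia.
Qed.

Lemma orb6s_uniq m : (0 < m)%N -> uniq (orb6s (m : int)).
Proof.
by move=> h; rewrite /orb6s /= !inE !xpair_eqE; repeat (apply/andP; split); lia.
Qed.

Lemma orb6l_uniq m : (0 < m)%N -> uniq (orb6l (m : int)).
Proof.
by move=> h; rewrite /orb6l /= !inE !xpair_eqE; repeat (apply/andP; split); lia.
Qed.

Lemma mem_orb12_0 : orb12 (0 : int, 0 : int) =i [:: (0, 0)].
Proof. by move=> [x y]; rewrite !inE !xpair_eqE; apply/idP/idP; lia. Qed.

Lemma mem_orb12_s x : orb12 (x, 0) =i orb6s x.
Proof.
by move=> u; rewrite /orb12 !(addr0, subr0, oppr0) !inE; do ?[case: (_ == _)].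
Qed.

Lemma mem_orb12_l y : orb12 (0, y) =i orb6l y.
Proof.
by move=> u; rewrite /orb12 !(add0r, oppr0, sub0r) !inE; do ?[case: (_ == _)].
Qed.

(** The signs of the values at the six positive coroots, x, y, x + y, x + 2y, x + 3y and 2x + 3y,
    determine a chamber containing [u], and with it the position of a dominant member in the
    list. *)
Lemma orb12_dominant (u : int * int) :
  exists m1 m2 : nat, (m1 : int, m2 : int) \in orb12 u.
Proof.
case: u => x y.
have H : exists2 w : int * int, w \in orb12 (x, y) & (0 <= w.1) && (0 <= w.2).
  have mem k : (k < 12)%N -> nth (0, 0) (orb12 (x, y)) k \in orb12 (x, y).
    by move=> hk; apply: mem_nth.
  suff [k hk hw] : exists2 k, (k < 12)%N & (0 <= (nth (0, 0) (orb12 (x, y)) k).1) &&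
      (0 <= (nth (0, 0) (orb12 (x, y)) k).2) by exists (nth (0, 0) (orb12 (x, y)) k); rewrite ?mem.
  have [x0|x0] := lerP 0 x; have [y0|y0] := lerP 0 y.
  - by exists 0%N => //=; lia.
  - have [s1|s1] := lerP 0 (x + (y + y + y)); first by exists 11 => //=; lia.
    have [s2|s2] := lerP 0 (x + (y + y)); first by exists 10 => //=; lia.
    have [s3|s3] := lerP 0 (x + x + (y + y + y)); first by exists 9 => //=; lia.
    have [s4|s4] := lerP 0 (x + y); first by exists 8 => //=; lia.
    by exists 7 => //=; lia.
  - have [s1|s1] := lerP 0 (x + y); first by exists 1%N => //=; lia.
    have [s2|s2] := lerP 0 (x + x + (y + y + y)); first by exists 2%N => //=; lia.
    have [s3|s3] := lerP 0 (x + (y + y)); first by exists 3%N => //=; lia.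
    have [s4|s4] := lerP 0 (x + (y + y + y)); first by exists 4%N => //=; lia.
    by exists 5%N => //=; lia.
  - by exists 6%N => //=; lia.
case: H => -[w1 w2] hw /= /andP[p1 p2]; exists (absz w1), (absz w2).
by rewrite !gez0_abs.
Qed.

(** The dominant chamber is a fundamental domain; this makes the orbits of distinct dominant weights
    disjoint. *)
Lemma orb12_dominant_inj (m1 m2 k1 k2 : nat) :
  (k1 : int, k2 : int) \in orb12 (m1 : int, m2 : int) -> (k1, k2) = (m1, m2).
Proof.
rewrite !inE !xpair_eqE => h.
suff [-> ->] : k1 = m1 /\ k2 = m2 by [].
move: h; repeat (case/orP; first by move=> /andP[/eqP ? /eqP ?]; lia).
by move=> /andP[/eqP ? /eqP ?]; lia.
Qed.

End IntegralOrbits.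

(** * Weyl orbits over the field, and the products over them *)

Section Orbits.

Variable F : numClosedFieldType.
Local Notation wt := (F * F)%type.
Implicit Types (a b c t z : F) (nu mu : wt).

Definition ipair (u : int * int) : wt := (u.1%:~R, u.2%:~R).

Lemma ipair_inj : injective ipair.
Proof. by move=> [x y] [x' y'] [] /intr_inj -> /intr_inj ->. Qed.

(** Multiples are written as repeated sums in [orb12], so additivity of the embedding of the
    integers suffices. *)
Lemma map_orb12 u : map ipair (orb12 u) = orb12 (ipair u).
Proof. by case: u => x y; rewrite /ipair /= !(rmorphD, rmorphN). Qed.

Lemma map_orb6s x : map ipair (orb6s x) = orb6s (x%:~R).
Proof. by rewrite /ipair /= !(rmorphD, rmorphN). Qed.

Lemma map_orb6l y : map ipair (orb6l y) = orb6l (y%:~R).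
Proof. by rewrite /ipair /= !(rmorphD, rmorphN). Qed.

(** In a dihedral group every element is an alternating word in the two reflections. The orbit is
    therefore a cycle, which closes up after twelve steps. *)
Fixpoint chain k mu : wt :=
  if k is k'.+1 then
    if odd k' then wref2 (chain k' mu) else wref1 (chain k' mu)
  else mu.

Lemma chain_even k mu : ~~ odd k -> chain k.+1 mu = wref1 (chain k mu).
Proof. by move=> /negbTE h; rewrite /= h. Qed.

Lemma chain_odd k mu : odd k -> chain k.+1 mu = wref2 (chain k mu).
Proof. by move=> h; rewrite /= h. Qed.

Arguments chain : simpl never.

Lemma orb12_chain mu :
  orb12 mu = [seq chain k mu | k <- iota 0 12] /\ chain 12 mu = mu.
Proof.
case: mu => x y.
have c1 : chain 1 (x, y) = (- x, x + y).
  by rewrite chain_even // /wref1 /=; congr (_, _); ring.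
have c2 : chain 2 (x, y) = (x + x + (y + y + y), - x - y).
  by rewrite chain_odd // c1 /wref2 /=; congr (_, _); ring.
have c3 : chain 3 (x, y) = (- (x + x + (y + y + y)), x + (y + y)).
  by rewrite chain_even // c2 /wref1 /=; congr (_, _); ring.
have c4 : chain 4 (x, y) = (x + (y + y + y), - x - (y + y)).
  by rewrite chain_odd // c3 /wref2 /=; congr (_, _); ring.
have c5 : chain 5 (x, y) = (- x - (y + y + y), y).
  by rewrite chain_even // c4 /wref1 /=; congr (_, _); ring.
have c6 : chain 6 (x, y) = (- x, - y).
  by rewrite chain_odd // c5 /wref2 /=; congr (_, _); ring.
have c7 : chain 7 (x, y) = (x, - x - y).
  by rewrite chain_even // c6 /wref1 /=; congr (_, _); ring.
have c8 : chain 8 (x, y) = (- (x + x + (y + y + y)), x + y).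
  by rewrite chain_odd // c7 /wref2 /=; congr (_, _); ring.
have c9 : chain 9 (x, y) = (x + x + (y + y + y), - x - (y + y)).
  by rewrite chain_even // c8 /wref1 /=; congr (_, _); ring.
have c10 : chain 10 (x, y) = (- x - (y + y + y), x + (y + y)).
  by rewrite chain_odd // c9 /wref2 /=; congr (_, _); ring.
have c11 : chain 11 (x, y) = (x + (y + y + y), - y).
  by rewrite chain_even // c10 /wref1 /=; congr (_, _); ring.
have c12 : chain 12 (x, y) = (x, y).
  by rewrite chain_odd // c11 /wref2 /=; congr (_, _); ring.
by split; rewrite // -[iota 0 12]/[:: 0; 1; 2; 3; 4; 5; 6; 7; 8; 9; 10; 11]%N !map_cons
  c1 c2 c3 c4 c5 c6 c7 c8 c9 c10 c11.
Qed.

Lemma chain12 mu : chain 12 mu = mu.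
Proof. exact: (orb12_chain mu).2. Qed.

Lemma mem_orb12P nu mu : reflect (exists2 k, (k < 12)%N & nu = chain k mu) (nu \in orb12 mu).
Proof.
rewrite (orb12_chain mu).1; apply: (iffP mapP) => [[k hk ->]|[k hk ->]]; exists k => //.
  by rewrite mem_iota in hk.
by rewrite mem_iota.
Qed.

Lemma orb12_refl mu : mu \in orb12 mu.
Proof. by apply/mem_orb12P; exists 0%N. Qed.

(** From an even position of the cycle the first reflection moves one step forward, from an odd
    position one step back. *)
Lemma orb12_ref1 nu mu : nu \in orb12 mu -> wref1 nu \in orb12 mu.
Proof.
move=> /mem_orb12P[k hk ->]; apply/mem_orb12P; have [ok|ok] := boolP (odd k).
  case: k hk ok => // k hk /= ok; exists k; first by lia.
  by rewrite chain_even // wref1K.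
exists k.+1; last by rewrite chain_even.
by have : k != 11%N; [apply: contraNneq ok => ->|lia].
Qed.

(** The parities are exchanged here, and positions 11 and 0 are neighbours because the cycle closes
    up. *)
Lemma orb12_ref2 nu mu : nu \in orb12 mu -> wref2 nu \in orb12 mu.
Proof.
move=> /mem_orb12P[k hk ->]; apply/mem_orb12P; have [ok|ok] := boolP (odd k).
  have [e|k11] := eqVneq k 11%N; last by exists k.+1; [lia|rewrite chain_odd].
  by exists 0%N => //; rewrite e -chain_odd // chain12.
case: k hk ok => [_ _|k hk /= ok].
  by exists 11 => //; rewrite -[in LHS](chain12 mu) chain_odd // wref2K.
by exists k; [lia|rewrite negbK in ok; rewrite chain_odd // wref2K].
Qed.

Lemma orb12_connected mu : weyl_connected mu (orb12 mu).
Proof.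
move=> P Pmu PS nu /mem_orb12P[k _ ->]; elim: k => // k IH.
by have [ok|ok] := boolP (odd k); [rewrite chain_odd|rewrite chain_even] => //; apply PS.
Qed.

Lemma orb12_sub nu mu : nu \in orb12 mu -> {subset orb12 nu <= orb12 mu}.
Proof.
move=> h x; apply: (orb12_connected (P := fun x => x \in orb12 mu)) => //.
by move=> y hy; rewrite orb12_ref1 ?orb12_ref2.
Qed.

Lemma orb12_sym nu mu : nu \in orb12 mu -> mu \in orb12 nu.
Proof.
apply: (orb12_connected (P := fun x => mu \in orb12 x)); first exact: orb12_refl.
move=> {}nu h; split; apply: (orb12_sub _ h).
  by rewrite -{1}(wref1K nu) orb12_ref1 // orb12_refl.
by rewrite -{1}(wref2K nu) orb12_ref2 // orb12_refl.
Qed.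

Definition wact (w : seq bool) mu : wt :=
  foldr (fun (s : bool) nu => if s then wref2 nu else wref1 nu) mu w.

(* Sealed, because unification must not evaluate the 4095 words of [words 11]. *)
Fact worb_key mu : {L : seq wt | L = undup [seq wact w mu | w <- words 11]}.
Proof. by exists (undup [seq wact w mu | w <- words 11]). Qed.

Definition worb mu : seq wt := sval (worb_key mu).

Lemma worbE mu : worb mu = undup [seq wact w mu | w <- words 11].
Proof. exact: (svalP (worb_key mu)). Qed.

Lemma mem_words w k : (size w <= k)%N -> w \in words k.
Proof.
elim: k w => [|k IH] [|b w] //= hw; rewrite inE; apply/orP; right.
rewrite cats0 mem_cat; have {}IH := IH w hw.
by case: b; rewrite (map_f _ IH) ?orbT.
Qed.

Lemma mem_worb mu : worb mu =i orb12 mu.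
Proof.
move=> nu; rewrite worbE mem_undup; apply/mapP/idP => [[w _ ->]|].
  by elim: w => [|[] w IH] /=; [exact: orb12_refl|exact: orb12_ref2|exact: orb12_ref1].
move=> /mem_orb12P[k hk ->].
(* The alternating word that acts as [chain k]. *)
pose fix alt k := if k is k'.+1 then odd k' :: alt k' else [::].
have sz j : size (alt j) = j by elim: j => //= j ->.
exists (alt k); first by apply: mem_words; rewrite sz.
elim: k {hk} => // k IH; have [ok|ok] := boolP (odd k).
  by rewrite chain_odd // IH /= ok.
by rewrite chain_even // IH /= (negbTE ok).
Qed.

Lemma worb_orb12 nu mu : nu \in worb mu -> nu \in orb12 mu.
Proof. by rewrite mem_worb. Qed.

Lemma worb_meet mu mu' nu : nu \in worb mu -> nu \in worb mu' -> mu' \in orb12 mu.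
Proof.
move=> /worb_orb12 h /worb_orb12 h'.
exact: (orb12_sub h (orb12_sym h')).
Qed.

Lemma worb_uniq mu : uniq (worb mu).
Proof. by rewrite worbE undup_uniq. Qed.

Lemma worb_perm mu (L : seq (int * int)) (u : int * int) :
  mu = ipair u -> uniq L -> orb12 u =i L -> perm_eq (worb mu) (map ipair L).
Proof.
move=> -> uL eL; apply: uniq_perm; rewrite ?worb_uniq ?map_inj_uniq //; first exact: ipair_inj.
by move=> nu; rewrite mem_worb -map_orb12; apply: eq_mem_map.
Qed.

Lemma worb_connected mu : weyl_connected mu (worb mu).
Proof. by move=> P Pm PS nu; rewrite mem_worb; apply: orb12_connected. Qed.

(** As the sum is 0, the factors z + n_i multiply to X + n1 n2 n3 and the factors z - n_i to X - n1
    n2 n3, with the same X. *)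
Lemma symmetric_triple z (n1 n2 n3 : F) : n1 + n2 + n3 = 0 ->
  (z + n1) * (z - n1) * ((z + n2) * (z - n2)) * ((z + n3) * (z - n3)) =
  (z ^+ 3 + (n1 * n2 + n1 * n3 + n2 * n3) * z) ^+ 2 - (n1 * n2 * n3) ^+ 2.
Proof. by move=> /eqP; rewrite addr_eq0 => /eqP h; rewrite -[n3]opprK -h; ring. Qed.

(** The values of the orbit are those of [n1], [n2], [n3], [k1], [k2], [k3] and their negatives.
    Each triple comes from an orbit of the rotations of order 3, hence has sum 0. *)
Lemma wprod_orb12 mu z a b : wprod (orb12 mu) z a b = (f12 mu).@[zpt z (hvec a b)].
Proof.
case: mu => x y; rewrite f12_h.
pose n1 := a * x + b * y; pose n2 := a * (x + y * 3) - b * (x + y * 2).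
pose n3 := b * (x + y) - a * (x * 2 + y * 3).
pose k1 := b * (x + y) - a * x; pose k2 := b * y - a * (x + y * 3).
pose k3 := a * (x * 2 + y * 3) - b * (x + y * 2).
have sn : n1 + n2 + n3 = 0 by rewrite /n1 /n2 /n3; ring.
have sk : k1 + k2 + k3 = 0 by rewrite /k1 /k2 /k3; ring.
transitivity (((z + n1) * (z - n1) * ((z + n2) * (z - n2)) * ((z + n3) * (z - n3))) *
    ((z + k1) * (z - k1) * ((z + k2) * (z - k2)) * ((z + k3) * (z - k3)))).
  rewrite /wprod /orb12 !big_cons big_nil /wval /=.
  have -> : a * (- x) + b * (- y) = - n1 by rewrite /n1; ring.
  have -> : a * (x + (y + y + y)) + b * (- x - (y + y)) = n2 by rewrite /n2; ring.
  have -> : a * (- x - (y + y + y)) + b * (x + (y + y)) = - n2 by rewrite /n2; ring.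
  have -> : a * (- (x + x + (y + y + y))) + b * (x + y) = n3 by rewrite /n3; ring.
  have -> : a * (x + x + (y + y + y)) + b * (- x - y) = - n3 by rewrite /n3; ring.
  have -> : a * (- x) + b * (x + y) = k1 by rewrite /k1; ring.
  have -> : a * x + b * (- x - y) = - k1 by rewrite /k1; ring.
  have -> : a * (- x - (y + y + y)) + b * y = k2 by rewrite /k2; ring.
  have -> : a * (x + (y + y + y)) + b * (- y) = - k2 by rewrite /k2; ring.
  have -> : a * (x + x + (y + y + y)) + b * (- x - (y + y)) = k3 by rewrite /k3; ring.
  have -> : a * (- (x + x + (y + y + y))) + b * (x + (y + y)) = - k3 by rewrite /k3; ring.
  by rewrite -/n1; ring.
rewrite !symmetric_triple //; congr ((_ - _) * (_ - _)).
- by rewrite /n1 /n2 /n3 /cQ /e2 /=; congr (_ ^+ _); ring.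
- by rewrite /n1 /n2 /n3 /cA /cB /e3 /disc /=; congr (_ ^+ _); field.
- by rewrite /k1 /k2 /k3 /cQ /e2 /=; congr (_ ^+ _); ring.
(* The product of the k's is minus (cA e3 - cB disc), hence the change of sign under the square. *)
- by rewrite /k1 /k2 /k3 /cA /cB /e3 /disc /= -[LHS]sqrrN; congr (_ ^+ _); field.
Qed.

Lemma wprod_orb6s (x : F) z a b : wprod (orb6s x) z a b = (f6 (x, 0)).@[zpt z (hvec a b)].
Proof.
rewrite f6_h /wprod /orb6s !big_cons big_nil /wval /cQ /cA /cB /e2 /e3 /disc /=; by field.
Qed.

Lemma wprod_orb6l (y : F) z a b : wprod (orb6l y) z a b = (f6 (0, y)).@[zpt z (hvec a b)].
Proof.
rewrite f6_h /wprod /orb6l !big_cons big_nil /wval /cQ /cA /cB /e2 /e3 /disc /=; by field.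
Qed.

Lemma wprod_perm (L L' : seq wt) z a b : perm_eq L L' -> wprod L z a b = wprod L' z a b.
Proof. by move=> h; apply: perm_big. Qed.

Lemma f_mu_orbit (m1 m2 : nat) (mu := (m1%:R, m2%:R) : wt) :
  (forall z a b, (f_mu mu).@[zpt z (hvec a b)] = wprod (worb mu) z a b) /\
  (msize (f_mu mu) <= (size (worb mu)).+1)%N.
Proof.
have em : mu = ipair (m1 : int, m2 : int) by [].
have e0 m : (m%:R == 0 :> F) = (m == 0%N) by rewrite pnatr_eq0.
rewrite /f_mu [mu.1]/= [mu.2]/= !e0.
have [z1|p1] := posnP m1; have [z2|p2] := posnP m2.
- have h : perm_eq (worb mu) (map ipair [:: (0, 0)]).
    by apply: (worb_perm em) => //; rewrite z1 z2; exact: mem_orb12_0.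
  split=> [z a b|] /=; last by rewrite (perm_size h) msizeX mdeg1.
  by rewrite (wprod_perm _ _ _ h) /wprod big_seq1 /wval /= !mulr0 !addr0 mevalXU zpt0.
- have h : perm_eq (worb mu) (map ipair (orb6l (m2 : int))).
    by apply: (worb_perm em); [exact: orb6l_uniq|rewrite z1; exact: mem_orb12_l].
  split=> [z a b|] /=; last by rewrite (perm_size h) size_map; exact: f6_deg.
  by rewrite (wprod_perm _ _ _ h) map_orb6l wprod_orb6l /mu z1.
- have h : perm_eq (worb mu) (map ipair (orb6s (m1 : int))).
    by apply: (worb_perm em); [exact: orb6s_uniq|rewrite z2; exact: mem_orb12_s].
  split=> [z a b|] /=; last by rewrite (perm_size h) size_map; exact: f6_deg.
  by rewrite (wprod_perm _ _ _ h) map_orb6s wprod_orb6s /mu z2.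
have h := @worb_perm mu _ _ em (orb12_uniq p1 p2) (fun _ => erefl).
split=> [z a b|] /=; last by rewrite (perm_size h) size_map; exact: f12_deg.
by rewrite (wprod_perm _ _ _ h) map_orb12 -em wprod_orb12.
Qed.

End Orbits.

Lemma flatten_map_uniq (S T : eqType) (W : S -> seq T) (s : seq S) : uniq s ->
  (forall x, uniq (W x)) -> {in s &, forall x y t, t \in W x -> t \in W y -> y = x} ->
  uniq (flatten (map W s)).
Proof.
move=> + uW; elim: s => //= x s IH /andP[xs us] h; rewrite cat_uniq uW /=; apply/andP; split.
  apply/hasPn => t /flatten_mapP[y hy ty]; apply/negP => tx.
  by rewrite -(h x y (mem_head _ _) _ t tx ty) ?hy // ?inE ?hy ?orbT in xs.
by apply: IH => // y z hy hz; apply: h; rewrite inE ?hy ?hz orbT.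
Qed.

(** * Integrality of eigenvalues for sl2-triples *)

Section Sl2.

Variables (F : numClosedFieldType) (n : nat).
Implicit Types (X h : 'M[F]_n) (v : 'cV[F]_n).

Lemma iter_eigen X h s v c k : h *m X - X *m h = s *: X -> h *m v = c *: v ->
  h *m iter k (mulmx X) v = (c + k%:R * s) *: iter k (mulmx X) v.
Proof.
move=> hX hv; elim: k => [|k IH]; first by rewrite mul0r addr0.
move/eqP: hX; rewrite subr_eq => /eqP hX.
rewrite iterS mulmxA hX mulmxDl -scalemxAl -mulmxA IH -scalemxAr -scalerDl.
by congr (_ *: _); rewrite -natr1; ring.
Qed.

(** Nonzero iterates are eigenvectors of [h] for distinct eigenvalues c + k s, so the characteristic
    polynomial bounds their number. *)
Lemma iter_eigen_nilp X h s v c : s != 0 -> h *m X - X *m h = s *: X ->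
  h *m v = c *: v -> v != 0 ->
  exists2 k, iter k (mulmx X) v != 0 & X *m iter k (mulmx X) v = 0.
Proof.
move=> s0 hX hv v0.
suff ex : exists k, iter k (mulmx X) v == 0.
  have [[|k] /eqP k0 kmin] := ex_minnP ex; first by move: k0 v0 => /= ->; rewrite eqxx.
  exists k => //; apply/negP => h0; by have := kmin _ h0; rewrite ltnn.
pose p := char_poly h^T; pose rs := [seq c + k%:R * s | k <- iota 0 (size p)].
case: (boolP (has (fun k => iter k (mulmx X) v == 0) (iota 0 (size p)))) => [/hasP[k _ hk]|nh].
  by exists k.
have p0 : p != 0 by rewrite monic_neq0 // char_poly_monic.
have ar : all (root p) rs.
  apply/allP => _ /mapP[k kI ->]; rewrite -eigenvalue_root_char; apply/eigenvalueP.
  exists (iter k (mulmx X) v)^T.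
    by rewrite -trmx_mul (iter_eigen k hX hv) linearZ.
  rewrite -[0]trmx0 (inj_eq trmx_inj); apply: contra nh => k0; apply/hasP; by exists k.
have us : uniq rs.
  rewrite map_inj_uniq ?iota_uniq // => i j /addrI /(mulIf s0) /eqP.
  by rewrite eqr_nat => /eqP.
by have := max_poly_roots p0 ar us; rewrite size_map size_iota ltnn.
Qed.

Variables e f h : 'M[F]_n.
Hypothesis he : h *m e - e *m h = 2 *: e.
Hypothesis hf : h *m f - f *m h = - 2 *: f.
Hypothesis ef : e *m f - f *m e = h.

Lemma sl2_highest v c : v != 0 -> e *m v = 0 -> h *m v = c *: v -> exists m : nat, c = m%:R.
Proof.
move=> v0 ev hv.
(* The classical relation e f^(k+1) v = (k+1)(c - k) f^k v. At the last nonzero f^k v its left side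
   is 0, which forces c = k. *)
have E k : e *m iter k.+1 (mulmx f) v = (k.+1%:R * (c - k%:R)) *: iter k (mulmx f) v.
  have efE : e *m f = h + f *m e by rewrite -ef subrK.
  elim: k => [|k IH]; rewrite iterS mulmxA efE mulmxDl -mulmxA.
    by rewrite /= ev mulmx0 addr0 hv; congr (_ *: _); ring.
  rewrite IH -scalemxAr (iter_eigen _ hf hv) -iterS -scalerDl; congr (_ *: _).
  by rewrite -!natr1; ring.
have n20 : - 2 != 0 :> F by rewrite oppr_eq0 pnatr_eq0.
have [k k0 k1] := iter_eigen_nilp n20 hf hv v0.
exists k; have := E k; rewrite iterS k1 mulmx0 => /esym/eqP.
by rewrite scaler_eq0 (negbTE k0) orbF mulf_eq0 pnatr_eq0 /= subr_eq0 => /eqP.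
Qed.

(** Applying [e] until it kills the vector gives a highest weight vector of eigenvalue c + 2k, which
    is a natural number. *)
Lemma sl2_integral v c : v != 0 -> h *m v = c *: v -> exists m : int, c = m%:~R.
Proof.
move=> v0 hv.
have n20 : 2 != 0 :> F by rewrite pnatr_eq0.
have [k k0 k1] := iter_eigen_nilp n20 he hv v0.
have [m hm] := sl2_highest k0 k1 (iter_eigen k he hv).
exists (m%:Z - k%:Z *+ 2); rewrite rmorphB rmorphMn /= -!pmulrn -hm -[k%:R *+ 2]mulr_natr.
by rewrite addrK.
Qed.

End Sl2.

(** * Weights of an irreducible representation and the factorization of its determinant *)

Section Representation.

Variables (F : numClosedFieldType) (n : nat) (phi : 'I_14 -> 'M[F]_n).
Local Notation P15 := {mpoly F[15]}.
Local Notation wt := (F * F)%type.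
Implicit Types (a b c z : F) (nu mu : wt).

Hypothesis phi_rep : is_rep phi.
Hypothesis n_gt0 : (0 < n)%N.
Hypothesis phi_irr :
  forall U : 'M[F]_n, (forall i, (U *m (phi i)^T <= U)%MS) -> U = 0 \/ row_full U.

Definition wm mu : nat :=
  \rank (eigenspace (phi h1)^T mu.1 :&: eigenspace (phi h2)^T mu.2)%MS.

Lemma bracket_h1 j : phi h1 *m phi j - phi j *m phi h1 = (rt 0 j)%:~R *: phi j.
Proof.
rewrite phi_rep (bigD1 j) //= g2_sc_h1 eqxx big1 ?addr0 // => k /negbTE kj.
by rewrite g2_sc_h1 eq_sym kj scale0r.
Qed.

Lemma bracket_h2 j : phi h2 *m phi j - phi j *m phi h2 = (rt 1 j)%:~R *: phi j.
Proof.
rewrite phi_rep (bigD1 j) //= g2_sc_h2 eqxx big1 ?addr0 // => k /negbTE kj.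
by rewrite g2_sc_h2 eq_sym kj scale0r.
Qed.

Lemma bracket_coroot i j k0 : (i < 14)%N -> (j < 14)%N -> (k0 < 14)%N ->
  all (fun k => sct i j k == if k == k0 then 1 else 0) (iota 0 14) ->
  phi (inord i) *m phi (inord j) - phi (inord j) *m phi (inord i) = phi (inord k0).
Proof.
move=> i14 j14 k14 H; rewrite phi_rep (bigD1 (inord k0)) //= big1 => [|k kk].
  have /eqP := ord_allP H (inord k0); rewrite g2_sctE !inordK // eqxx => ->.
  by rewrite addr0 scale1r.
have /eqP := ord_allP H k; rewrite g2_sctE !inordK // => ->.
by move: kk; rewrite -val_eqE /= inordK // => /negbTE ->; rewrite scale0r.
Qed.

(** Each phi_j shifts the eigenvalues of phi_h, so the sum [U] of all eigenspaces is a
    subrepresentation. It is not 0, since an eigenvalue exists, hence it is everything. *)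
Lemma diagonalizable_h (h : 'I_14) (w : 'I_14 -> F) :
  (forall j, phi h *m phi j - phi j *m phi h = w j *: phi j) ->
  mxpoly.diagonalizable (phi h)^T.
Proof.
move=> hw; set A := (phi h)^T.
have shift r j : (eigenspace A r *m (phi j)^T <= eigenspace A (r + w j))%MS.
  apply/eigenspaceP; rewrite -mulmxA -trmx_mul.
  have /eqP := hw j; rewrite subr_eq => /eqP ->.
  rewrite linearD linearZ /= mulmxDr -scalemxAr trmx_mul mulmxA addrC.
  have /eigenspaceP -> := submx_refl (eigenspace A r).
  by rewrite -scalemxAl -scalerDl.
have p0 : char_poly A != 0 by rewrite monic_neq0 // char_poly_monic.
have [r0 rE] := closed_field_poly_normal (char_poly A).
pose rs := undup r0.
have rsP a : eigenvalue A a = (a \in rs).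
  rewrite eigenvalue_root_char rE rootZ ?lead_coef_eq0 // mem_undup.
  by rewrite root_prod_XsubC.
pose U : 'M[F]_n := (\sum_(i < size rs) eigenspace A rs`_i)%MS.
have subU a : (eigenspace A a <= U)%MS.
  have [|] := boolP (eigenvalue A a); last first.
    by rewrite /eigenvalue negbK => /eqP ->; rewrite sub0mx.
  rewrite rsP => ars; have ha : (index a rs < size rs)%N by rewrite index_mem.
  by apply: (sumsmx_sup (Ordinal ha)) => //=; rewrite nth_index.
have Uinv i : (U *m (phi i)^T <= U)%MS.
  rewrite sumsmxMr; apply/sumsmx_subP => k _.
  exact: submx_trans (shift _ _) (subU _).
apply/mxpoly.diagonalizablePeigen; exists rs; first exact: undup_uniq.
rewrite (big_nth 0) big_mkord; apply/eqmxP; rewrite submx1 /= sub1mx.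
case: (phi_irr Uinv) => // U0.
have [a ha] : exists a, root (char_poly A) a.
  by apply/closed_rootP; rewrite size_char_poly; case: n n_gt0.
move: ha; rewrite -eigenvalue_root_char /eigenvalue -submx0.
by have := subU a; rewrite U0 => ->.
Qed.

Lemma codiagonalization : exists P : 'M[F]_n, exists d1 d2 : 'rV[F]_n,
  [/\ P \in unitmx, P *m (phi h1)^T = diag_mx d1 *m P & P *m (phi h2)^T = diag_mx d2 *m P].
Proof.
have c12 : comm_mx (phi h1)^T (phi h2)^T.
  rewrite /comm_mx -!trmx_mul; congr trmx; apply/esym/eqP; rewrite -subr_eq0.
  by rewrite bracket_h1 val_h2 scale0r.
have [P Pu] : mxpoly.codiagonalizable [:: (phi h1)^T; (phi h2)^T].
  apply/mxpoly.codiagonalizableP; split=> A.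
    by move=> B; rewrite !inE => /orP[] /eqP -> /orP[] /eqP ->.
  rewrite !inE => /orP[] /eqP ->; first exact: (diagonalizable_h bracket_h1).
  exact: (diagonalizable_h bracket_h2).
move=> /= /and3P[/mxpoly.diagonalizable_forPex[d1 /(mxpoly.simmxP Pu) e1]].
move=> /mxpoly.diagonalizable_forPex[d2 /(mxpoly.simmxP Pu) e2] _.
by exists P, d1, d2.
Qed.

Section Weights.

Variables (P : 'M[F]_n) (d1 d2 : 'rV[F]_n).
Hypothesis Pu : P \in unitmx.
Hypothesis P1 : P *m (phi h1)^T = diag_mx d1 *m P.
Hypothesis P2 : P *m (phi h2)^T = diag_mx d2 *m P.

Definition wts : seq wt := [seq (d1 ord0 i, d2 ord0 i) | i <- enum 'I_n].

Lemma wts_eigen nu : nu \in wts -> exists2 v : 'cV[F]_n, v != 0 &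
  phi h1 *m v = nu.1 *: v /\ phi h2 *m v = nu.2 *: v.
Proof.
move=> /mapP[i _ ->] /=; exists (row i P)^T.
  rewrite -[0]trmx0 (inj_eq trmx_inj).
  have : row_free P by rewrite row_free_unit.
  move=> /row_freeP[B PB]; apply/eqP => r0; have := congr1 (row i) PB.
  by rewrite row_mul r0 mul0mx => /esym/rowP/(_ i)/eqP; rewrite !mxE eqxx oner_eq0.
split; apply: trmx_inj; rewrite trmx_mul linearZ /= trmxK.
  by rewrite -row_mul P1 row_mul row_diag_mx -scalemxAl -rowE.
by rewrite -row_mul P2 row_mul row_diag_mx -scalemxAl -rowE.
Qed.

Lemma det_wts z a b : \det (z%:M + a *: phi h1 + b *: phi h2) = wprod wts z a b.
Proof.
have Pd : \det P != 0 by rewrite -unitfE -unitmxE.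
have trE : (z%:M + a *: phi h1 + b *: phi h2)^T = z%:M + a *: (phi h1)^T + b *: (phi h2)^T.
  by rewrite !linearD !linearZ /= tr_scalar_mx.
apply: (mulfI Pd); rewrite -[\det (_ + _)]det_tr trE -det_mulmx.
have -> : P *m (z%:M + a *: (phi h1)^T + b *: (phi h2)^T) =
    diag_mx (\row_i (z + (a * d1 ord0 i + b * d2 ord0 i))) *m P.
  rewrite !mulmxDr -!scalemxAr P1 P2 !scalemxAl scalar_mxC -!mulmxDl; congr (_ *m _).
  apply/matrixP => i j; rewrite !mxE; case: eqP => _; rewrite ?mulr1n ?mulr0n ?mulr0 ?addr0 //.
  by rewrite addrA.
rewrite det_mulmx mulrC det_diag; congr (_ * _).
by rewrite /wprod /wts big_map big_enum; apply: eq_bigr => i _; rewrite mxE.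
Qed.

(** In the eigenbasis [P] the joint eigenspace is spanned by the rows of weight [mu]; [J] is the
    coordinate projection onto these rows. *)
Lemma wm_count mu : wm mu = count_mem mu wts.
Proof.
pose Q i := (d1 ord0 i, d2 ord0 i) == mu.
pose J : 'M[F]_n := diag_mx (\row_i (Q i)%:R).
have QE i : (Q i)%:R * d1 ord0 i = mu.1 * (Q i)%:R /\ (Q i)%:R * d2 ord0 i = mu.2 * (Q i)%:R.
  by rewrite /Q; case: eqP => [<-|_] /=; rewrite ?mul0r ?mulr0 ?mul1r ?mulr1.
have JD (d : 'rV[F]_n) c : (forall i, (Q i)%:R * d ord0 i = c * (Q i)%:R) ->
    J *m diag_mx d = c *: J.
  move=> hd; rewrite mulmx_diag; apply/matrixP => i j; rewrite !mxE hd.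
  by rewrite [RHS]mulrnAr.
have e : (eigenspace (phi h1)^T mu.1 :&: eigenspace (phi h2)^T mu.2 :=: J *m P)%MS.
  apply/eqmxP/andP; split; last first.
    rewrite sub_capmx; apply/andP; split; apply/eigenspaceP; rewrite -mulmxA ?P1 ?P2 mulmxA.
      by rewrite (JD _ mu.1) ?scalemxAl // => i; case: (QE i).
    by rewrite (JD _ mu.2) ?scalemxAl // => i; case: (QE i).
  apply/row_subP => k; set v := row k _.
  have : (v <= eigenspace (phi h1)^T mu.1 :&: eigenspace (phi h2)^T mu.2)%MS by exact: row_sub.
  rewrite sub_capmx => /andP[/eigenspaceP v1 /eigenspaceP v2].
  pose u := v *m invmx P.
  have vu : v = u *m P by rewrite /u mulmxKV.
  have un (d : 'rV[F]_n) A c : P *m A = diag_mx d *m P -> v *m A = c *: v ->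
      forall i, u ord0 i * d ord0 i = c * u ord0 i.
    move=> PA vA i; have : u *m diag_mx d = c *: u.
      apply: (can_inj (mulmxK Pu)); rewrite -mulmxA -PA mulmxA -vu vA -scalemxAl.
      by rewrite -vu.
    by move=> /matrixP/(_ ord0 i); rewrite mul_mx_diag !mxE.
  have uJ : u = u *m J.
    apply/matrixP => l i; rewrite (ord1 l) mul_mx_diag [RHS]mxE [X in _ * X]mxE /Q.
    case: eqP => [_|ne]; first by rewrite mulr1.
    rewrite mulr0; apply/eqP; apply: contra_notT ne => ui.
    have h c x : u ord0 i * x = c * u ord0 i -> x = c.
      by rewrite mulrC => /(mulIf ui).
    by rewrite (h _ _ (un _ _ _ P1 v1 i)) (h _ _ (un _ _ _ P2 v2 i)) -surjective_pairing.
  by rewrite vu uJ -mulmxA submxMl.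
rewrite /wm e mxrankMfree ?row_free_unit //.
have eJ : (J :=: \sum_(i | Q i) <<delta_mx 0 i : 'rV[F]_n>>)%MS.
  apply/eqmxP/andP; split.
    apply/row_subP => i; rewrite row_diag_mx mxE; have [Qi|_] := boolP (Q i); last first.
      by rewrite scale0r sub0mx.
    by rewrite scale1r (sumsmx_sup i) // genmxE.
  apply/sumsmx_subP => i Qi; rewrite genmxE.
  have -> : delta_mx 0 i = row i J by rewrite row_diag_mx mxE Qi scale1r.
  exact: row_sub.
have dJ : mxdirect (\sum_(i | Q i) <<delta_mx 0 i : 'rV[F]_n>>)%MS.
  by apply: (@mxdirect_delta _ _ Q n id) => // i j _ _.
rewrite eJ (mxdirectP dJ) /=.
under eq_bigr do rewrite mxrank_gen mxrank_delta.
by rewrite sum1_card /wts count_map cardE size_filter -enumT; apply: eq_count => i.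
Qed.

(** The triples b_2, b_8, h_1 and b_3, b_9, h_2 are sl2-triples. *)
Lemma wts_integral nu : nu \in wts -> exists u : int * int, nu = ipair F u.
Proof.
move=> /wts_eigen[v v0 [v1 v2]].
have i14 k : (k < 14)%N -> (inord k : 'I_14) = k :> nat by move=> hk; rewrite inordK.
have [x hx] : exists m : int, nu.1 = m%:~R.
  apply: (@sl2_integral _ _ (phi (inord 2)) (phi (inord 8)) (phi h1)) v0 v1.
  - by rewrite bracket_h1 i14.
  - by rewrite bracket_h1 i14.
  - by rewrite (@bracket_coroot 2 8 0).
have [y hy] : exists m : int, nu.2 = m%:~R.
  apply: (@sl2_integral _ _ (phi (inord 3)) (phi (inord 9)) (phi h2)) v0 v2.
  - by rewrite bracket_h2 i14.
  - by rewrite bracket_h2 i14.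
  - by rewrite (@bracket_coroot 3 9 1).
by exists (x, y); rewrite /ipair /= -hx -hy -surjective_pairing.
Qed.

Definition fdet : P15 := \det (('X_ord0 : P15)%:M + gM phi).

Lemma fdet_invariant : invariant fdet.
Proof. by move=> i _; apply: gD_det. Qed.

Lemma fdet_h z a b : fdet.@[zpt z (hvec a b)] = wprod wts z a b.
Proof.
rewrite -det_wts /fdet -det_map_mx; congr (\det _).
apply/matrixP => i j; rewrite !mxE /= mevalD -addrA; congr (_ + _).
  by case: eqP; rewrite ?mulr1n ?mulr0n ?meval0 ?mevalXU ?zpt0.
rewrite /gM summxE rmorph_sum /=.
under eq_bigr => l _ do rewrite !mxE mevalM mevalXU zptE mevalC mxE.
have n12 : (h2 == h1) = false by rewrite -val_eqE /= val_h1 val_h2.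
rewrite (bigD1 h1) //= (bigD1 h2) /= ?n12 // !eqxx big1 ?addr0 // => l /andP[l1 l2].
by rewrite (negbTE l1) (negbTE l2) mul0r.
Qed.

(** For an h that separates all weights of both lists, the polynomial in z_0 determines its roots
    with multiplicity, and the roots determine the weights. *)
Lemma wprod_inj (L L' : seq wt) :
  (forall z a b, wprod L z a b = wprod L' z a b) -> perm_eq L L'.
Proof.
move=> e; have [t tP] := wval_separation (L ++ L').
pose g nu := - wval nu 1 t.
have gP : {in L ++ L' &, injective g} by move=> x y hx hy /oppr_inj; apply: tP.
have : perm_eq (map g L) (map g L').
  apply: prod_XsubC_eq; apply: eq_poly_horner => z; rewrite !big_map !horner_prod.
  have := e z 1 t; rewrite /wprod; under eq_bigr do rewrite -[wval _ _ _]opprK -hornerXsubC.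
  by under [RHS]eq_bigr do rewrite -[wval _ _ _]opprK -hornerXsubC.
move=> /seq.permP p; apply/allP => x hx /=; apply/eqP; have := p (pred1 (g x)).
rewrite !count_map; congr (_ = _); apply: eq_in_count => y hy /=.
  by rewrite (inj_in_eq gP) // mem_cat hy.
by rewrite (inj_in_eq gP) // mem_cat hy orbT.
Qed.

(** By invariance of [fdet], reflecting all weights leaves the product on h unchanged; by
    [wprod_inj] the reflection permutes [wts]. *)
Lemma wts_ref1 nu : count_mem (wref1 nu) wts = count_mem nu wts.
Proof.
have /seq.permP p : perm_eq (map (@wref1 F) wts) wts.
  apply: wprod_inj => z a b; rewrite /wprod big_map.
  under eq_bigr do rewrite wval_ref1.
  by have := invariant_s1 z a b fdet_invariant; rewrite !fdet_h.
rewrite -p count_map; apply: eq_count => x /=.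
by rewrite (inj_eq (inv_inj (@wref1K F))).
Qed.

Lemma wts_ref2 nu : count_mem (wref2 nu) wts = count_mem nu wts.
Proof.
have /seq.permP p : perm_eq (map (@wref2 F) wts) wts.
  apply: wprod_inj => z a b; rewrite /wprod big_map.
  under eq_bigr do rewrite wval_ref2.
  by have := invariant_s2 z a b fdet_invariant; rewrite !fdet_h.
rewrite -p count_map; apply: eq_count => x /=.
by rewrite (inj_eq (inv_inj (@wref2K F))).
Qed.

Lemma wts_orbit nu mu : nu \in orb12 mu -> count_mem nu wts = count_mem mu wts.
Proof.
apply: (orb12_connected (P := fun x => count_mem x wts = count_mem mu wts)) => // x hx.
by rewrite wts_ref1 wts_ref2.
Qed.

Lemma mem_wts nu : (nu \in wts) = (0 < count_mem nu wts)%N.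
Proof. by rewrite -has_count has_pred1. Qed.

(** Both sides are invariant, so they may be compared on h. There the linear factors are grouped by
    Weyl orbits, on which the multiplicity is constant. *)
Lemma fdet_factorization (s : seq wt) : uniq s ->
  (forall mu, mu \in s <->
    ((exists k : nat, mu.1 = k%:R) /\ (exists k : nat, mu.2 = k%:R)) /\ (0 < wm mu)%N) ->
  fdet = \prod_(mu <- s) f_mu mu ^+ wm mu.
Proof.
move=> us sP.
have dom mu : mu \in s -> exists m1 m2 : nat, mu = (m1%:R, m2%:R).
  by move=> /sP[[[k1 e1] [k2 e2]] _]; exists k1, k2; rewrite -e1 -e2 -surjective_pairing.
apply: invariant_eq; first exact: fdet_invariant.
  move=> i hi; apply: (derivation_prod_eq0 (@gDM F i)) => mu _.
  by apply: gDX_eq0; apply: f_mu_invariant.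
move=> z a b; rewrite fdet_h rmorph_prod /=.
have -> : wprod wts z a b = \prod_(nu <- undup wts) (z + wval nu a b) ^+ count_mem nu wts.
  by rewrite prodr_undup_exp_count.
(* The distinct weights are the disjoint union of the orbits of the dominant ones. *)
have pe : perm_eq (undup wts) (flatten (map (@worb F) s)).
  apply: uniq_perm; first exact: undup_uniq.
    apply: flatten_map_uniq => //; first exact: worb_uniq.
    move=> mu mu' hmu hmu' t ht ht'.
    have := worb_meet ht ht'; have [m1 [m2 ->]] := dom _ hmu; have [k1 [k2 ->]] := dom _ hmu'.
    rewrite -[(k1%:R, k2%:R)]/(ipair F (k1 : int, k2 : int)).
    rewrite -[(m1%:R, m2%:R)]/(ipair F (m1 : int, m2 : int)).
    rewrite -map_orb12 mem_map; last exact: ipair_inj.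
    by move=> /orb12_dominant_inj [-> ->].
  move=> nu; rewrite mem_undup; apply/idP/flatten_mapP => [hnu|[mu hmu]].
    have [u eu] := wts_integral hnu; have [m1 [m2 hm]] := orb12_dominant u.
    pose mu := ipair F (m1 : int, m2 : int).
    have hmu : mu \in orb12 nu by rewrite eu -map_orb12 map_f.
    exists mu; last by rewrite mem_worb orb12_sym.
    apply/sP; split; first by split; [exists m1|exists m2].
    by rewrite wm_count (wts_orbit hmu) -mem_wts.
  rewrite mem_worb => /wts_orbit h; have /sP[_] := hmu.
  by rewrite wm_count -h -mem_wts.
rewrite (perm_big _ pe) big_flatten big_map big_seq [RHS]big_seq; apply: eq_bigr => mu hmu.
have [m1 [m2 em]] := dom _ hmu.
rewrite rmorphXn /= wm_count em (f_mu_orbit F m1 m2).1 -em /wprod -prodrXl.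
rewrite big_seq [RHS]big_seq; apply: eq_bigr => nu; rewrite mem_worb => /wts_orbit h.
by rewrite h.
Qed.

End Weights.

Lemma rep_factorization (s : seq wt) : uniq s ->
  (forall mu, mu \in s <->
    ((exists k : nat, mu.1 = k%:R) /\ (exists k : nat, mu.2 = k%:R)) /\ (0 < wm mu)%N) ->
  fdet = \prod_(mu <- s) f_mu mu ^+ wm mu.
Proof.
have [P [d1 [d2 [Pu P1 P2]]]] := codiagonalization.
exact: (fdet_factorization Pu P1 P2).
Qed.

End Representation.

(** * Degree and irreducibility of the orbital factors *)

Section Irreducibility.

Variables (F : numClosedFieldType) (m1 m2 : nat).
Let mu : F * F := (m1%:R, m2%:R).

Lemma size_worb_gt0 : (0 < size (worb mu))%N.
Proof.
have : mu \in worb mu by rewrite mem_worb orb12_refl.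
by case: (worb mu).
Qed.

(** The construction bounds the degree from above; the restriction to h = 0, monic in z_0, bounds it
    from below. *)
Lemma msize_f_mu : msize (f_mu mu) = (size (worb mu)).+1.
Proof.
have [h sz] := f_mu_orbit F m1 m2.
by apply/eqP; rewrite eqn_leq sz msize_wprod.
Qed.

Lemma f_mu_neq0 : f_mu mu != 0.
Proof. by rewrite -msize_poly_eq0 msize_f_mu. Qed.

Lemma f_mu_nonunit : f_mu mu \isn't a GRing.unit.
Proof.
apply/negP => /andP[/eqP e _]; have := msize_f_mu; rewrite e msizeC.
by have := size_worb_gt0; case: (size _) => // k _; case: eqP.
Qed.

Lemma f_mu_irreducible q r :
  f_mu mu = q * r -> q \is a GRing.unit \/ r \is a GRing.unit.
Proof.
have [h sz] := f_mu_orbit F m1 m2.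
apply: (wprod_irreducible (@f_mu_invariant F mu) h (worb_uniq mu) _ (@worb_connected F mu) sz).
by rewrite mem_worb orb12_refl.
Qed.

End Irreducibility.

(** * Agreement with the notions in the statement *)

Section Bridge.

Variable R : realType.
Local Notation C := (R[i]).

Lemma ad_mx_adm i : ad_mx R i = adm i.
Proof. by apply/matrixP => k j; rewrite !mxE. Qed.

Lemma Ad_exp_Adx i (t : C) : Ad_exp i t = Adx i t.
Proof. by rewrite /Ad_exp ad_mx_adm. Qed.

Lemma sref1_wref1 (mu : weight R) : sref1 mu = wref1 mu.
Proof.
rewrite /sref1 /simple_root g2_sc_h1 g2_sc_h2 eqxx inordK // /wref1.
by rewrite -[rt 0 2]/(2 : int) -[rt 1 2]/(-1 : int) /=; congr (_, _); ring.
Qed.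

Lemma sref2_wref2 (mu : weight R) : sref2 mu = wref2 mu.
Proof.
rewrite /sref2 /simple_root g2_sc_h1 g2_sc_h2 eqxx inordK // /wref2.
by rewrite -[rt 0 3]/(-3 : int) -[rt 1 3]/(2 : int) /=; congr (_, _); ring.
Qed.

Lemma weyl_orbit_worb (mu : weight R) : weyl_orbit mu = worb mu.
Proof.
rewrite worbE /weyl_orbit; congr undup; apply: eq_map => w.
by elim: w => //= s w ->; rewrite sref1_wref1 sref2_wref2.
Qed.

Lemma f_mu_orbital_factor (m1 m2 : nat) (mu := (m1%:R, m2%:R) : weight R) :
  orbital_factor mu (f_mu mu).
Proof.
split=> [z a b|i t z x hi].
  rewrite weyl_orbit_worb.
  exact: (f_mu_orbit _ m1 m2).1.
rewrite Ad_exp_Adx.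
by apply: gD_invariant => //; apply: f_mu_invariant.
Qed.

End Bridge.

Theorem theorem4p11 (R : realType) (n : nat) (phi : 'I_14 -> 'M[R[i]]_n) :
  is_g2_rep phi -> irreducible_rep phi ->
  forall s : seq (weight R),
    uniq s ->
    (forall mu : weight R, mu \in s <-> dominant mu /\ (0 < wmult phi mu)%N) ->
    exists f : weight R -> Pol R,
      (forall mu, mu \in s -> orbital_factor mu (f mu)) /\
      f_phi phi = \prod_(mu <- s) f mu ^+ wmult phi mu /\
      (forall mu, mu \in s ->
         mirreducible (f mu) /\ msize (f mu) = (size (weyl_orbit mu)).+1).
Proof.
move=> phi_rep [n_gt0 phi_irr] s us sP.
have dom mu : mu \in s -> exists m1 m2 : nat, mu = (m1%:R, m2%:R).
  by move=> /sP[[[k1 e1] [k2 e2]] _]; exists k1, k2; rewrite -e1 -e2 -surjective_pairing.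
exists (@f_mu _); split; last split.
- by move=> mu /dom[m1 [m2 ->]]; exact: f_mu_orbital_factor.
- exact: (@rep_factorization _ n phi phi_rep n_gt0 phi_irr s us sP).
move=> mu /dom[m1 [m2 ->]]; split; last by rewrite weyl_orbit_worb; exact: msize_f_mu.
split; first exact: f_mu_neq0.
by split; [exact: f_mu_nonunit|exact: f_mu_irreducible].
Qed.
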